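(* Let $\Omega\subset\mathbb{R}^N$ be a bounded open set, let $\gamma>1$, and let $g\in L^N(\Omega)$ with $g\ge 0$ and $\|g\|_{L^N(\Omega)}\le 1$. Then the problem $$-\mathrm{div}\left(\frac{Du}{|Du|}\right)+\frac{|Du|}{(1-u)^{\gamma}}=g \ \text{ in } \Omega,\qquad u=0\ \text{ on }\partial\Omega,$$ has at least one solution $u\in BV(\Omega)$ (in the sense defined in the context).
   Context: $BV(\Omega)$ is the space of functions $u\in L^1(\Omega)$ whose distributional derivative $Du$ is a Radon measure with finite total variation; $Du=D^a u+D^j u+D^c u$ is its decomposition into absolutely continuous, jump and Cantor parts, and $u^*$ denotes the precise representative of $u$. $\mathcal{DM}_\infty(\Omega)$ is the set of $\mathbf{z}\in L^\infty(\Omega,\mathbb{R}^N)$ such that the distributional divergence $\mathrm{div}(\mathbf{z})$ is a bounded measure in $\Omega$. For $\mathbf{z}\in\mathcal{DM}_\infty(\Omega)$ and $u\in BV(\Omega)\cap L^\infty(\Omega)$, the (Anzellotti) pairing $(\mathbf{z},Du)$ is the distribution, which is in fact a Radon measure, given by $$\langle(\mathbf{z},Du),\varphi\rangle=-\int_\Omega u^*\varphi\,\mathrm{div}(\mathbf{z})-\int_\Omega u\,\mathbf{z}\cdot D\varphi\,dx,\qquad \varphi\in C_0^\infty(\Omega).$$ Definition of solution: $u\in BV(\Omega)$ is a solution of the problem if $0\le u<1$ a.e. in $\Omega$, $|D^j u|=0$, and there exists $\mathbf{z}\in\mathcal{DM}_\infty(\Omega)$ with $\|\mathbf{z}\|_{L^\infty(\Omega)}\le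 1$ such that (i) $-\mathrm{div}(\mathbf{z})+\frac{|Du|}{(1-u)^\gamma}=g$ in $\mathcal{D}'(\Omega)$, where $\frac{|Du|}{(1-u)^\gamma}$ denotes the measure with density $(1-u^* )^{-\gamma}$ with respect to $|Du|$; (ii) $(\mathbf{z},Du)=|Du|$ as measures in $\Omega$; (iii) $u|_{\partial\Omega}=0$ in the trace sense. *)

(* Defs.v *)
From HB Require Import structures.
From mathcomp Require Import all_boot all_order all_algebra.
From mathcomp Require Import all_classical all_reals all_analysis.
From mathcomp Require Import measurable_realfun.

Set Implicit Arguments.
Unset Strict Implicit.
Unset Printing Implicit Defensive.

Import Order.TTheory GRing.Theory Num.Theory.
Import numFieldNormedType.Exports.

Local Open Scope classical_set_scope.
Local Open Scope ring_scope.

Definition borel_display : measure_display.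
Proof. exact: default_measure_display. Qed.

Section borel_rV.
Context {R : realType} {n : nat}.

Let borel : set (set 'rV[R]_n) := <<s open >>.

Let borel0 : borel set0.
Proof. exact: sigma_algebra0. Qed.

Let borelC A : borel A -> borel (~` A).
Proof. by move=> bA; rewrite -setTD; exact: sigma_algebraCD. Qed.

Let borel_bigcup (F : (set 'rV[R]_n)^nat) :
  (forall i, borel (F i)) -> borel (\bigcup_i F i).
Proof. exact: sigma_algebra_bigcup. Qed.

HB.instance Definition _ := @isMeasurable.Build borel_display
  'rV[R]_n borel borel0 borelC borel_bigcup.

Lemma open_measurable_rV (U : set 'rV[R]_n) : open U -> measurable U.
Proof. exact: sub_sigma_algebra. Qed.

End borel_rV.

Section lebesgue_rV.
Context {R : realType}.

Definition cons_rV n (p : R * 'rV[R]_n) : 'rV[R]_n.+1 :=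
  \row_j (if unlift 0 j is Some k then p.2 0 k else p.1).

Definition uncons_rV n (v : 'rV[R]_n.+1) : R * 'rV[R]_n :=
  (v 0 0, \row_j v 0 (lift 0 j)).

Let rat_ball n (c : 'rV[rat]_n * nat) : set 'rV[R]_n :=
  [set v | forall j, `|ratr (c.1 0 j) - v 0 j| < c.2.+1%:R^-1].

Let open_rat_ball n (U : set 'rV[R]_n) : open U ->
  U = \bigcup_(c in [set c | rat_ball c `<=` U]) rat_ball c.
Proof.
move=> oU; apply/seteqP; split => [x Ux|x [c cU]]; last exact: cU.
have /nbhs_ballP[e /= e0 eU] : nbhs x U by exact: open_nbhs_nbhs.
have [k kP] : exists k : nat, k.+1%:R^-1 < e / 2.
  have [k _ /(_ k (leqnn k))] := near_infty_natSinv_lt (PosNum (divr_gt0 e0 (ltr0n R 2))).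
  by exists k.
have k0 : 0 < (k.+1%:R^-1 : R) by rewrite invr_gt0.
have /boolp.choice [q qP] : forall j, exists q : rat,
    `|ratr q - x 0 j| < (k.+1%:R^-1 : R).
  move=> j; have /rat_in_itvoo[q] : x 0 j < x 0 j + k.+1%:R^-1 by rewrite ltrDl.
  rewrite in_itv/= => /andP[q1 q2]; exists q.
  by rewrite ger0_norm ?subr_ge0 ?ltW// ltrBlDl.
exists (\row_j q j, k) => /=; last by move=> j; rewrite mxE.
move=> y yq; apply: eU; split => // i j; rewrite (ord1 i).
have := yq j; rewrite /= mxE => yj.
rewrite /ball /= -(subrKA (ratr (q j))).
rewrite (le_lt_trans (ler_normD _ _))// (splitr e) ltrD//.
  by rewrite distrC (lt_trans _ kP).
exact: lt_trans kP.
Qed.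

Lemma measurable_fun_rV n d (T : measurableType d) (f : T -> 'rV[R]_n) :
  (forall j, measurable_fun setT (fun t => f t 0 j)) -> measurable_fun setT f.
Proof.
move=> mf; apply: (@measurability _ _ T 'rV[R]_n setT f open erefl).
move=> _ [U oU <-]; rewrite setTI (open_rat_ball oU) preimage_bigcup.
rewrite bigcup_mkcond.
apply: countable_bigcupT_measurable => // c; case: ifPn => // _.
have -> : f @^-1` rat_ball c = \bigcap_(j in [set: 'I_n])
    (fun t => f t 0 j) @^-1` ball (ratr (c.1 0 j) : R) c.2.+1%:R^-1.
  apply/seteqP; split => t /= h; first by move=> j _; exact: h.
  by move=> j; exact: h.
apply: fin_bigcap_measurable => // j _.
by rewrite -[X in measurable X]setTI; apply: mf => //; apply: open_measurable; exact: ball_open.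
Qed.

Lemma measurable_coord_rV n (j : 'I_n) :
  measurable_fun [set: 'rV[R]_n] (fun v : 'rV[R]_n => v 0 j).
Proof.
apply: (measurability _ (RGenOpens.measurableE R)) => _ [_ [a [b ->]] <-].
rewrite setTI; apply: open_measurable_rV.
by apply: open_comp => [v _|]; [exact: coord_continuous|exact: interval_open].
Qed.

Lemma measurable_cons_rV n : measurable_fun [set: R * 'rV[R]_n] (@cons_rV n).
Proof.
apply: measurable_fun_rV => j; under eq_fun do rewrite mxE.
case: unliftP => [k _|_]; last exact: measurable_fst.
exact: measurableT_comp (measurable_coord_rV k) measurable_snd.
Qed.

Lemma measurable_uncons_rV n : measurable_fun [set: 'rV[R]_n.+1] (@uncons_rV n).
Proof.
apply/measurable_fun_pairP; split; first exact: measurable_coord_rV.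
apply: measurable_fun_rV => j; rewrite /uncons_rV/=.
under eq_fun do rewrite mxE; exact: measurable_coord_rV.
Qed.

Lemma cons_rVK n : cancel (@cons_rV n) (@uncons_rV n).
Proof.
move=> [x v]; rewrite /uncons_rV; congr (_, _).
  by rewrite mxE unlift_none.
by apply/rowP => j; rewrite !mxE liftK.
Qed.

Section step.
Context {n : nat} (m : {sigma_finite_measure set 'rV[R]_n -> \bar R}).

Definition lebesgue_rV_step : set 'rV[R]_n.+1 -> \bar R :=
  pushforward (@lebesgue_measure R \x m)%E (@cons_rV n).

Let step0 : lebesgue_rV_step set0 = 0%E.
Proof. by rewrite /lebesgue_rV_step /pushforward preimage_set0 measure0. Qed.

Let step_ge0 A : (0 <= lebesgue_rV_step A)%E.
Proof. by apply: measure_ge0; exact: measurable_cons_rV. Qed.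

Let step_sigma_additive : semi_sigma_additive lebesgue_rV_step.
Proof.
move=> F mF tF mUF; rewrite /lebesgue_rV_step.
by apply: measure_semi_sigma_additive => //; exact: measurable_cons_rV.
Qed.

HB.instance Definition _ := isMeasure.Build _ _ _ lebesgue_rV_step
  step0 step_ge0 step_sigma_additive.

Let step_sigma_finite : sigma_finite setT lebesgue_rV_step.
Proof.
have /sigma_finiteP[F [TF ndF mF]] := sigma_finiteT (@lebesgue_measure R).
have /sigma_finiteP[G [TG ndG mG]] := sigma_finiteT m.
exists (fun k => @uncons_rV n @^-1` (F k `*` G k)) => [|k].
  apply/esym; rewrite -subTset => v _.
  have [i _ Fi] : (\bigcup_i F i) (uncons_rV v).1 by rewrite -TF.
  have [j _ Gj] : (\bigcup_i G i) (uncons_rV v).2 by rewrite -TG.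
  exists (maxn i j) => //; split.
  - by move: Fi; exact/subsetPset/ndF/leq_maxl.
  - by move: Gj; exact/subsetPset/ndG/leq_maxr.
have [mFk Fk] := mF k; have [mGk Gk] := mG k.
have mFG := measurableX mFk mGk; split.
  by rewrite -[X in measurable X]setTI; exact: measurable_uncons_rV.
rewrite /lebesgue_rV_step /pushforward -comp_preimage.
rewrite (_ : _ \o _ = id); last by apply/funext => p; exact: cons_rVK.
by rewrite preimage_id product_measure1E// lte_mul_pinfty// ge0_fin_numE.
Qed.

HB.instance Definition _ := Measure_isSigmaFinite.Build _ _ _ lebesgue_rV_step
  step_sigma_finite.

End step.

(* n-dimensional Lebesgue measure on the Borel sets, as an iterated product. *)
Fixpoint lebesgue_rV n : {sigma_finite_measure set 'rV[R]_n -> \bar R} :=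
  match n with
  | 0 => \d_(0 : 'rV[R]_0)
  | n'.+1 => lebesgue_rV_step (lebesgue_rV n')
  end.

End lebesgue_rV.

Section euclidean.
Context {R : realType} {n : nat}.
Implicit Types (x v w : 'rV[R]_n) (r : R).

(* The library norm on 'rV[R]_n is the sup norm. *)
Definition edot v w : R := \sum_(i < n) v 0 i * w 0 i.
Definition enorm v : R := Num.sqrt (edot v v).
Definition eball x r : set 'rV[R]_n := [set y | enorm (y - x) < r].

End euclidean.

Section test_functions.
Context {R : realType} {n : nat}.
Implicit Types (Omega : set 'rV[R]_n) (f phi : 'rV[R]_n -> R).

Definition pderiv (i : 'I_n) f : 'rV[R]_n -> R := 'D_(delta_mx 0 i) f.

Definition grad f (x : 'rV[R]_n) : 'rV[R]_n := \row_i pderiv i f x.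

Definition smooth f := forall s : seq 'I_n,
  let fs := foldr pderiv f s in
  continuous fs /\ forall i x, derivable fs x (delta_mx 0 i).

Definition support f : set 'rV[R]_n := closure [set x | f x != 0].

Definition test_function Omega phi :=
  [/\ smooth phi, compact (support phi) & support phi `<=` Omega].

Definition eq_distribution Omega (S T : ('rV[R]_n -> R) -> R) :=
  forall phi, test_function Omega phi -> S phi = T phi.

End test_functions.

Section charges.
Context {R : realType} {n : nat}.
Local Notation charges := ({charge set 'rV[R]_n -> \bar R})%R.

Definition charge_integral (nu : charges) (A : set 'rV[R]_n)
    (f : 'rV[R]_n -> R) : R :=
  let: exist P exN := cid (Hahn_decomposition nu) in
  let: exist N nuPN := cid exN in
  \int[jordan_pos nuPN]_(x in A) f x - \int[jordan_neg nuPN]_(x in A) f x.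

(* A bounded R^n-valued Radon measure is the family of its components. Measures
   on an open set Omega are Borel charges on R^n of which only the values on
   subsets of Omega are used. *)
Definition vector_variation (nu : 'I_n -> charges) (A : set 'rV[R]_n) : \bar R :=
  ereal_sup [set s | exists F : (set 'rV[R]_n)^nat,
    [/\ forall k, measurable (F k), trivIset [set: nat] F,
        \bigcup_k F k = A
      & s = (\sum_(0 <= k <oo) (enorm (\row_i fine (nu i (F k))))%:E)%E]].

Definition is_variation (Omega : set 'rV[R]_n) (nu : 'I_n -> charges)
    (mu : {finite_measure set 'rV[R]_n -> \bar R}) :=
  forall A, measurable A -> A `<=` Omega -> mu A = vector_variation nu A.

End charges.

Section BV.
Context {R : realType} {n : nat}.
Local Notation leb := (@lebesgue_rV R n).
Local Notation charges := ({charge set 'rV[R]_n -> \bar R})%R.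
Implicit Types (Omega : set 'rV[R]_n) (u : 'rV[R]_n -> R).
Implicit Types (Du : 'I_n -> charges).

Definition is_gradient Omega u Du := forall i phi, test_function Omega phi ->
  \int[leb]_(x in Omega) (u x * pderiv i phi x) =
  - charge_integral (Du i) Omega phi.

Definition BV Omega u :=
  leb.-integrable Omega (EFin \o u) /\ exists Du, is_gradient Omega u Du.

Definition average (A : set 'rV[R]_n) u : R :=
  (fine (leb A))^-1 * \int[leb]_(x in A) u x.

Definition precise_representative Omega u (x : 'rV[R]_n) : R :=
  xget 0 [set l : R | average (Omega `&` eball x r) u @[r --> 0^'+] --> l].

Definition approx_limit Omega u (x : 'rV[R]_n) (l : R) :=
  average (Omega `&` eball x r) (fun y => `|u y - l|) @[r --> 0^'+] --> (0 : R).

Definition approx_discontinuity_set Omega u : set 'rV[R]_n :=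
  [set x | Omega x /\ ~ exists l, approx_limit Omega u x l].

Definition half_ball (x nu : 'rV[R]_n) (r : R) : set 'rV[R]_n :=
  [set y | eball x r y /\ 0 < edot (y - x) nu].

Definition approx_jump_set Omega u : set 'rV[R]_n :=
  [set x | Omega x /\ exists (a b : R) (nu : 'rV[R]_n),
    [/\ a != b, enorm nu = 1,
        average (Omega `&` half_ball x nu r) (fun y => `|u y - a|)
          @[r --> 0^'+] --> (0 : R)
      & average (Omega `&` half_ball x (- nu) r) (fun y => `|u y - b|)
          @[r --> 0^'+] --> (0 : R)]].

Definition is_lebesgue_decomposition Omega Du (Da Ds : 'I_n -> charges) :=
  [/\ forall i A, measurable A -> A `<=` Omega ->
        Du i A = (Da i A + Ds i A)%E,
      forall i A, measurable A -> A `<=` Omega -> leb A = 0%E -> Da i A = 0%E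
    & exists2 B, measurable B /\ leb B = 0%E &
        forall i A, measurable A -> A `<=` Omega -> A `&` B = set0 ->
          Ds i A = 0%E].

Definition is_BV_decomposition Omega u Du (Da Dj Dc : 'I_n -> charges) :=
  exists2 Ds, is_lebesgue_decomposition Omega Du Da Ds &
    forall i A, measurable A -> A `<=` Omega ->
      Dj i A = Ds i (A `&` approx_jump_set Omega u) /\
      Dc i A = Ds i (A `\` approx_discontinuity_set Omega u).

End BV.

Section hausdorff.
Context {R : realType} {n : nat}.
Implicit Types (A : set 'rV[R]_n).
Local Open Scope ereal_scope.

Definition diameter A : \bar R :=
  ereal_sup [set (enorm (p.1 - p.2)%R)%:E | p in A `*` A].

Definition hausdorff_size (s : nat) A : \bar R :=
  if A == set0 then 0 else diameter A ^+ s.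

(* s-dimensional Hausdorff measure up to its normalizing constant, which is
   irrelevant for null sets; for s = 0 it is the counting measure. *)
Definition hausdorff_measure (s : nat) A : \bar R :=
  ereal_sup [set ereal_inf [set \sum_(0 <= k <oo) hausdorff_size s (F k) |
      F in [set F : (set 'rV[R]_n)^nat | A `<=` \bigcup_k F k /\
                                         forall k, diameter (F k) <= delta%:E]]
    | delta in [set delta : R | (0 < delta)%R]].

End hausdorff.

Section trace.
Context {R : realType} {n : nat}.
Implicit Types (Omega : set 'rV[R]_n) (u tau : 'rV[R]_n -> R).

Definition frontier Omega := closure Omega `\` interior Omega.

(* approx_limit averages over Omega `&` eball x r only, hence is meaningful at
   boundary points as well. *)
Definition has_trace Omega u tau :=
  hausdorff_measure n.-1 [set x | frontier Omega x /\
    ~ approx_limit Omega u x (tau x)] = 0%E.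

End trace.

Section solution.
Context {R : realType} {n : nat}.
Local Notation leb := (@lebesgue_rV R n).
Local Notation charges := ({charge set 'rV[R]_n -> \bar R})%R.
Implicit Types (Omega : set 'rV[R]_n) (u g : 'rV[R]_n -> R).
Implicit Types (z : 'rV[R]_n -> 'rV[R]_n) (divz : charges).

Definition norm_L Omega (p : \bar R) u : \bar R :=
  ('N[leb]_p[EFin \o (u \_ Omega)])%E.

Definition is_divergence Omega z divz := forall phi, test_function Omega phi ->
  charge_integral divz Omega phi =
  - \int[leb]_(x in Omega) edot (z x) (grad phi x).

Definition DM_infty Omega z divz :=
  [/\ forall i, measurable_fun Omega (fun x => z x 0 i),
      (norm_L Omega +oo (enorm \o z) < +oo)%E
    & is_divergence Omega z divz].

Definition pairing Omega z divz u (phi : 'rV[R]_n -> R) : R :=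
  - charge_integral divz Omega
      (fun x => precise_representative Omega u x * phi x)
  - \int[leb]_(x in Omega) (u x * edot (z x) (grad phi x)).

(* (1 - u^* )^(- gamma); the inverse is taken in \bar R so that the weight is
   +oo, and not 0, where u^* = 1. *)
Definition weight Omega (gamma : R) u (x : 'rV[R]_n) : \bar R :=
  ((((1 - precise_representative Omega u x) `^ gamma)%:E)^-1)%E.

Definition solution Omega (gamma : R) g u :=
  [/\ BV Omega u,
      {ae leb, forall x, Omega x -> 0 <= u x < 1},
      has_trace Omega u (fun=> 0)
    & exists (Du : 'I_n -> charges)
             (absDu : {finite_measure set 'rV[R]_n -> \bar R}),
      [/\ is_gradient Omega u Du, is_variation Omega Du absDu,
          exists Da Dj Dc, is_BV_decomposition Omega u Du Da Dj Dc /\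
            vector_variation Dj Omega = 0%E
        & exists z divz,
          [/\ DM_infty Omega z divz,
              (norm_L Omega +oo (enorm \o z) <= 1)%E,
              forall K, compact K -> K `<=` Omega ->
                absDu.-integrable K (weight Omega gamma u),
              eq_distribution Omega
                (fun phi => - charge_integral divz Omega phi +
                  fine (\int[absDu]_(x in Omega)
                          ((phi x)%:E * weight Omega gamma u x))%E)
                (fun phi => \int[leb]_(x in Omega) (g x * phi x))
            & exists zDu : charges,
                eq_distribution Omega
                  (pairing Omega z divz u)
                  (charge_integral zDu Omega) /\
                forall A, measurable A -> A `<=` Omega -> zDu A = absDu A]]].

End solution.

(* Main.v *)
From HB Require Import structures.
Require Import Defs.
From mathcomp Require Import all_boot all_order all_algebra.
From mathcomp Require Import all_classical all_reals all_analysis.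
From mathcomp Require Import measurable_realfun ess_sup_inf ring lra.
Import Order.TTheory GRing.Theory Num.Theory.
Import numFieldNormedType.Exports.
Local Open Scope classical_set_scope.
Local Open Scope ring_scope.

(** The bound on the norm of [g] is so small that [u = 0] is a solution. For
    [u = 0] every term involving [Du] vanishes, the precise representative is
    [0] and the weight is [1], so that all that remains to be found is a bounded
    field [z] with [|z| <= 1] and [- div z = g] in [Omega]; this is
    [calibration].

    Such a field exists by duality. Since [- div z = g] means that
    [\int z . grad phi = \int g phi] for all test functions, one looks for a
    linear functional on fields with the value [\int g phi] at [grad phi], which
    is dominated by the [L^1] norm. On gradients this domination is the estimate
      [\int g phi <= ||g||_N ||phi||_(N/(N-1)) <= ||g||_N \int |grad phi|],
    that is, the inequality of Gagliardo, Nirenberg and Sobolev with constant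
    [1] ([gagliardo_nirenberg]), and it makes the functional well defined there.
    The theorem of Hahn and Banach ([hahn_banach]) extends it to all bounded
    measurable fields, and the duality between [L^1] and [L^oo]
    ([riesz_L1_dual]) represents the extension by a field [z] with [|z| <= 1].

    The Sobolev inequality is proved by induction on the dimension. Write
    [x = (t, y)] and let [F y] be the integral of [|d_t phi|] along the line
    over [y], so that [|phi (t, y)| <= F y]. Then
      [|phi|^(1 + 1/m) <= F^(1/m) |phi|],
    where [m] is the dimension of [y], and the inequality in dimension [m],
    applied to the slices [phi (t, .)] with the weight [F^(1/m)], bounds the
    integral of the right-hand side by [(\int |grad phi|)^(1 + 1/m)]. Hoelder's
    inequality concludes. The form with a weight [g] instead of an
    [L^(N/(N-1))] norm is thus exactly the one that the induction uses.

    The representation theorem rests on the theorem of Radon and Nikodym, which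
    represents the functional on indicators. Indicators determine it on bounded
    functions by [bounded_measurable_linear_eq0], a halving argument that also
    identifies the integral with respect to the charge [- g dx]. *)

(** * The theorem of Hahn and Banach *)

Section hahn_banach.
Context {R : realType} {V : lmodType R}.
Variables (D : set V) (p : V -> R).

(** A linear functional on a subspace is encoded by its graph. Domination by a
    sublinear [p] makes a linear relation single-valued, so that a functional
    given on a spanning set needs no separate proof of being well defined. *)
Definition dominated_linear_relation (G : set (V * R^o)) :=
  (forall a u v, G u -> G v -> G (a *: u + v)) /\
  (forall u, G u -> D u.1 /\ u.2 <= p u.1).

Hypothesis D_linear : forall a x y, D x -> D y -> D (a *: x + y).
Hypothesis p_sub : forall x y, D x -> D y -> p (x + y) <= p x + p y.
Hypothesis p_hom : forall a x, 0 < a -> D x -> p (a *: x) = a * p x.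

(** The one-dimensional extension. The value [c] at [v] has to lie between the
    numbers [w.2 - p (w.1 - v)] and the numbers [p (u.1 + v) - u.2]; subadditivity
    of [p] says that the former are below the latter. *)
Lemma dominated_linear_relation_extend (G : set (V * R^o)) (v : V) :
  G 0 -> dominated_linear_relation G -> D v ->
  exists c : R, dominated_linear_relation
    [set u | exists w a, G w /\ u = w + a *: (v, c)].
Proof.
move=> G00 [Glin Gp] Dv.
have D0 : D 0 by have [] := Gp _ G00.
have DZ a x : D x -> D (a *: x) by move=> Dx; rewrite -[_ *: _]addr0; apply: D_linear.
have DD x y : D x -> D y -> D (x + y).
  by move=> Dx Dy; rewrite -[x]scale1r; apply: D_linear.
have DN x : D x -> D (- x) by rewrite -scaleN1r; apply: DZ.
have GZ a u : G u -> G (a *: u) by move=> Gu; rewrite -[_ *: _]addr0; exact: Glin.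
have GD u w : G u -> G w -> G (u + w).
  by move=> Gu Gw; rewrite -[u]scale1r; exact: Glin.
pose L := [set w.2 - p (w.1 - v) | w in G].
have Lle u w : G u -> G w -> w.2 - p (w.1 - v) <= p (u.1 + v) - u.2.
  move=> Gu Gw; have [Du _] := Gp _ Gu; have [Dw _] := Gp _ Gw.
  have [_ /= h] := Gp _ (GD _ _ Gu Gw).
  have := p_sub _ _ (DD _ _ Du Dv) (DD _ _ Dw (DN _ Dv)).
  have -> : u.1 + v + (w.1 - v) = u.1 + w.1 by rewrite addrACA subrr addr0.
  lra.
have Lub : has_ubound L.
  by exists (p (0 + v) - 0) => _ [w Gw <-]; apply: (Lle 0).
have L0 : L !=set0 by exists (0 - p (0 - v)); exists 0.
pose c := sup L.
have cge w : G w -> w.2 - p (w.1 - v) <= c.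
  by move=> Gw; apply: ub_le_sup => //; exists w.
have cle u : G u -> c <= p (u.1 + v) - u.2.
  by move=> Gu; apply: ge_sup => // _ [w Gw <-]; exact: Lle.
exists c; split.
  move=> a _ _ [u [b [Gu ->]]] [w [b' [Gw ->]]].
  exists (a *: u + w), (a * b + b'); split; first exact: Glin.
  by rewrite scalerDr scalerA scalerDl addrACA.
move=> _ [w [a [Gw ->]]] /=; have [Dw wp] := Gp _ Gw.
split; first by apply: DD => //; apply: DZ.
(* By homogeneity only the multiples [a = 1] and [a = - 1] of [v] matter. *)
case: (ltgtP a 0) => [a0|a0|->]; last by rewrite !scale0r !addr0.
- have na0 : 0 < - a by rewrite oppr_gt0.
  have := cge _ (GZ (- a)^-1 _ Gw) => /=.
  move=> /(ler_wpM2l (ltW na0)).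
  rewrite mulrBr -p_hom//; last by apply: DD; [exact: DZ|exact: DN].
  rewrite scalerBr scalerA !mulrA /= divff ?gt_eqF// scale1r scaleNr opprK mul1r.
  by rewrite /GRing.scale/=; lra.
- have := cle _ (GZ a^-1 _ Gw) => /=.
  move=> /(ler_wpM2l (ltW a0)).
  rewrite mulrBr -p_hom//; last by apply: DD => //; exact: DZ.
  rewrite scalerDr scalerA !mulrA /= divff ?gt_eqF// scale1r mul1r.
  by rewrite /GRing.scale/=; lra.
Qed.

(** A maximal dominated linear relation containing [G0] is defined on all of
    [D], since it could otherwise be extended by one more vector. *)
Theorem hahn_banach (G0 : set (V * R^o)) :
  G0 0 -> dominated_linear_relation G0 ->
  exists f : V -> R,
    [/\ forall a x y, D x -> D y -> f (a *: x + y) = a * f x + f y,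
        forall x, D x -> f x <= p x
      & forall u, G0 u -> f u.1 = u.2].
Proof.
move=> G00 G0P.
(* The union with [G0] makes the empty chain harmless in Zorn's lemma. *)
have [|A [GP Amax]] := @Zorn_bigcup _ [set A | dominated_linear_relation (G0 `|` A)].
  move=> F FP Ftot; split; last first.
    move=> u [G0u|[X FX Xu]]; first exact: G0P.2.
    by apply: (FP _ FX).2; right.
  have up u v : (G0 `|` \bigcup_(X in F) X) u -> (G0 `|` \bigcup_(X in F) X) v ->
    (G0 u /\ G0 v) \/ exists2 X, F X & (G0 `|` X) u /\ (G0 `|` X) v.
    move=> [G0u|[X FX Xu]] [G0v|[Y FY Yv]]; first by left.
    - by right; exists Y => //; split; [left|right].
    - by right; exists X => //; split; [right|left].
    - right; have [XY|YX] := Ftot _ _ FX FY.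
        by exists Y => //; split; right => //; exact: XY.
      by exists X => //; split; right => //; exact: YX.
  move=> a u v /up/[apply] -[[Gu Gv]|[X FX [Xu Xv]]]; first by left; apply: G0P.1.
  have [//|?] := (FP _ FX).1 a u v Xu Xv; first by left.
  by right; exists X.
set G := G0 `|` A in GP.
have G_0 : G 0 by left.
have Gtot x : D x -> exists r : R, G (x, r).
  move=> Dx; apply: contrapT => nGx.
  have [c G'P] := dominated_linear_relation_extend _ _ G_0 GP Dx.
  set G' := [set u | _] in G'P.
  have GG' : G `<=` G'.
    by move=> u Gu; exists u, 0; split => //; rewrite scale0r addr0.
  apply: (Amax G').
    split; first by move=> u Au; apply: GG'; right.
    move=> G'A; apply: nGx; exists c; right; apply: G'A.
    by exists 0, 1; split => //; rewrite add0r scale1r.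
  rewrite /mkset; suff -> : G0 `|` G' = G' by [].
  by apply/setUidPr => u G0u; apply: GG'; left.
have [Glin Gp] := GP.
have G0r r : G (0, r) -> r = 0.
  have D0 : D 0 by have [] := Gp _ G_0.
  have p0 : p 0 = 0.
    by have := p_hom 2 0 (ltr0n _ 2) D0; rewrite scaler0; lra.
  move=> Gr; have [_] := Gp _ Gr; rewrite p0 => r0.
  have [_] := Gp _ (Glin (- 1) _ _ Gr G_0).
  rewrite addr0 /= scaler0 p0 /GRing.scale/=; move: r0 => /=; lra.
have Guniq x r s : G (x, r) -> G (x, s) -> r = s.
  move=> Gr Gs; have := Glin (- 1) _ _ Gs Gr.
  rewrite [_ + _](_ : _ = (0, r - s) :> V * R^o); last first.
    congr pair; first by rewrite /= scaleN1r addNr.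
    by rewrite /= scaleN1r addrC.
  by move=> /G0r/eqP; rewrite subr_eq0 => /eqP.
pose f x := xget 0 [set r | G (x, r)].
have fP x : D x -> G (x, f x).
  by move=> /Gtot[r Gr]; rewrite /f; case: xgetP => // /(_ r).
exists f; split.
- move=> a x y Dx Dy; apply: (Guniq (a *: x + y)); first exact/fP/D_linear.
  exact: Glin (fP _ Dx) (fP _ Dy).
- by move=> x Dx; have [] := Gp _ (fP _ Dx).
- move=> [x r] /= G0r'; have Gr : G (x, r) by left.
  by apply: (Guniq x) => //; apply: fP; have [] := Gp _ Gr.
Qed.
End hahn_banach.

(** * The Euclidean norm *)

Section euclidean_norm.
Context {R : realType} {n : nat}.
Implicit Types v w : 'rV[R]_n.

Lemma edotDl u v w : edot (u + v) w = edot u w + edot v w.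
Proof.
by rewrite /edot -big_split/=; apply: eq_bigr => i _; rewrite mxE mulrDl.
Qed.

Lemma edotZl a v w : edot (a *: v) w = a * edot v w.
Proof. by rewrite /edot mulr_sumr; apply: eq_bigr => i _; rewrite mxE mulrA. Qed.

Lemma edotC v w : edot v w = edot w v.
Proof. by apply: eq_bigr => i _; rewrite mulrC. Qed.

Lemma edotDr u v w : edot u (v + w) = edot u v + edot u w.
Proof. by rewrite edotC edotDl !(edotC u). Qed.

Lemma edotZr a v w : edot v (a *: w) = a * edot v w.
Proof. by rewrite edotC edotZl edotC. Qed.

Lemma edot_ge0 v : 0 <= edot v v.
Proof. by apply: sumr_ge0 => i _; rewrite -expr2 sqr_ge0. Qed.

Lemma enorm_ge0 v : 0 <= enorm v.
Proof. exact: sqrtr_ge0. Qed.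

Lemma sqr_enorm v : enorm v ^+ 2 = edot v v.
Proof. by rewrite sqr_sqrtr// edot_ge0. Qed.

Lemma enormZ a v : enorm (a *: v) = `|a| * enorm v.
Proof.
rewrite /enorm edotZl edotC edotZl mulrA -expr2 sqrtrM ?sqr_ge0//.
by rewrite sqrtr_sqr.
Qed.

Lemma coord_le_enorm v i : `|v 0 i| <= enorm v.
Proof.
rewrite -sqrtr_sqr ler_wsqrtr// /edot (bigD1 i)//= expr2 lerDl.
by apply: sumr_ge0 => j _; rewrite -expr2 sqr_ge0.
Qed.

Lemma enorm_eq0 v : enorm v = 0 -> v = 0.
Proof.
move=> v0; apply/rowP => i; rewrite mxE; apply/eqP.
by rewrite -normr_le0 -v0 coord_le_enorm.
Qed.

(** The Cauchy-Schwarz inequality: expand the square of the norm of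
    [|w| v - |v| w]. *)
Lemma edot_le v w : edot v w <= enorm v * enorm w.
Proof.
have [v0|v0] := eqVneq (enorm v) 0.
  rewrite v0 mul0r (enorm_eq0 _ v0) /edot big1// => i _.
  by rewrite mxE mul0r.
have [w0|w0] := eqVneq (enorm w) 0.
  rewrite w0 mulr0 (enorm_eq0 _ w0) /edot big1// => i _.
  by rewrite mxE mulr0.
have vp : 0 < enorm v by rewrite lt0r v0 enorm_ge0.
have wp : 0 < enorm w by rewrite lt0r w0 enorm_ge0.
have := edot_ge0 (enorm w *: v + (- enorm v) *: w).
rewrite edotDl !edotDr !edotZl !edotZr -!sqr_enorm (edotC w v) => h.
have : 0 <= 2 * (enorm v * enorm w) * (enorm v * enorm w - edot v w) by nra.
by rewrite pmulr_rge0 ?subr_ge0// mulr_gt0// mulr_gt0.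
Qed.

Lemma normr_edot_le v w : `|edot v w| <= enorm v * enorm w.
Proof.
rewrite ler_norml edot_le andbT lerNl -mulN1r -edotZl.
by rewrite (le_trans (edot_le _ _))// enormZ normrN1 mul1r.
Qed.

Lemma enorm0 : enorm (0 : 'rV[R]_n) = 0.
Proof. by rewrite -(scale0r 0) enormZ normr0 mul0r. Qed.

Lemma enormD v w : enorm (v + w) <= enorm v + enorm w.
Proof.
rewrite -(@ler_pXn2r _ 2) ?nnegrE ?addr_ge0 ?enorm_ge0//.
rewrite sqr_enorm edotDl !edotDr -!sqr_enorm.
by rewrite (edotC w v); have := edot_le v w; nra.
Qed.

Lemma enorm_delta i : enorm (delta_mx 0 i : 'rV[R]_n) = 1.
Proof.
rewrite /enorm /edot (bigD1 i)//= big1 ?addr0.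
  by rewrite !mxE !eqxx mulr1 sqrtr1.
by move=> j /negbTE ji; rewrite !mxE ji !andbF mulr0.
Qed.

Lemma enorm_le_sum v : enorm v <= \sum_(i < n) `|v 0 i|.
Proof.
rewrite {1}[v]row_sum_delta.
elim/big_ind2 : _ => [|x1 x2 y1 y2 h1 h2|i _].
- by rewrite enorm0.
- by rewrite (le_trans (enormD _ _))// lerD.
- by rewrite enormZ enorm_delta mulr1.
Qed.

Context {d} {T : measurableType d}.

Lemma measurable_edot (D : set T) (F G : T -> 'rV[R]_n) :
  (forall i, measurable_fun D (fun x => F x 0 i)) ->
  (forall i, measurable_fun D (fun x => G x 0 i)) ->
  measurable_fun D (fun x => edot (F x) (G x)).
Proof.
move=> mF mG; apply: measurable_sum => i; exact: measurable_funM.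
Qed.

Lemma measurable_enorm (D : set T) (F : T -> 'rV[R]_n) :
  (forall i, measurable_fun D (fun x => F x 0 i)) ->
  measurable_fun D (fun x => enorm (F x)).
Proof.
move=> mF; apply: (measurableT_comp (f := @Num.sqrt R)).
  by apply: continuous_measurable_fun; exact: sqrt_continuous.
exact: measurable_edot.
Qed.

End euclidean_norm.

(** * Bounded measurable functions *)

Section bounded_measurable.
Context {d} {T : measurableType d} {R : realType}.
Implicit Types (f g : T -> R) (a C : R) (A : set T).

Definition bounded_measurable f :=
  measurable_fun [set: T] f /\ exists C, forall x, `|f x| <= C.

Lemma bounded_measurable_lin a f g : bounded_measurable f ->
  bounded_measurable g -> bounded_measurable (a *: f + g).
Proof.
move=> [mf [C fC]] [mg [C' gC]]; split.
  by apply: measurable_funD => //; exact: measurable_funM.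
exists (`|a| * C + C') => x; rewrite (le_trans (ler_normD _ _))// lerD//.
by rewrite normrM ler_wpM2l.
Qed.

Lemma bounded_measurable_indic A : measurable A -> bounded_measurable \1_A.
Proof.
move=> mA; split; first exact: measurable_indic.
by exists 1 => x; rewrite indicE; case: (x \in A); rewrite ?normr1// normr0.
Qed.

Lemma bounded_measurable_cst C : bounded_measurable (cst C).
Proof. by split; [exact: measurable_cst|exists `|C| => x]. Qed.

Lemma bounded_measurableM f g : bounded_measurable f -> bounded_measurable g ->
  bounded_measurable (f \* g).
Proof.
move=> [mf [C fC]] [mg [C' gC]]; split; first exact: measurable_funM.
by exists (C * C') => x; rewrite /= normrM ler_pM.
Qed.

Lemma bounded_measurable_norm f : bounded_measurable f ->
  bounded_measurable (fun x => `|f x|).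
Proof.
move=> [mf [C fC]]; split; first exact: measurableT_comp.
by exists C => x; rewrite normr_id.
Qed.

Lemma bounded_measurable_integrable (mu : {finite_measure set T -> \bar R}) D f :
  measurable D -> bounded_measurable f -> mu.-integrable D (EFin \o f).
Proof.
move=> mD [mf [C fC]]; apply: (integrableS measurableT) => //.
apply: measurable_bounded_integrable => //.
  by rewrite -ge0_fin_numE// fin_num_measure.
exists C; split; [exact: num_real|move=> M CM x _].
  by apply: le_trans (fC x) (ltW CM).
Qed.

Lemma Rintegral_linear (mu : {measure set T -> \bar R}) D a f g :
  measurable D -> mu.-integrable D (EFin \o f) -> mu.-integrable D (EFin \o g) ->
  \int[mu]_(x in D) (a * f x + g x) =
  a * \int[mu]_(x in D) f x + \int[mu]_(x in D) g x.
Proof.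
move=> mD if_ ig; rewrite RintegralD ?RintegralZl//.
exact: (@integrableZl _ _ _ _ _ mD a _ if_).
Qed.

(** If [0 <= f <= C], subtracting [C / 2] times the indicator of [C / 2 <= f]
    leaves [e f] unchanged and halves the bound [C]. Hence [|e f| <= K C / 2^k]
    for all [k]. This replaces the approximation by simple functions. *)
Lemma bounded_measurable_linear_eq0 (e : (T -> R) -> R) K :
  (forall a f g, bounded_measurable f -> bounded_measurable g ->
    e (a *: f + g) = a * e f + e g) ->
  (forall A, measurable A -> e \1_A = 0) ->
  (forall f C, bounded_measurable f -> (forall x, `|f x| <= C) ->
    `|e f| <= K * C) ->
  forall f, bounded_measurable f -> e f = 0.
Proof.
move=> elin e1 eK.
have halve k f C : bounded_measurable f -> (forall x, 0 <= f x <= C) ->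
    `|e f| <= K * (C / 2 ^+ k).
  elim: k f C => [|k IH] f C bf fC.
    rewrite expr0 divr1; apply: eK => // x.
    by have /andP[f0 fC'] := fC x; rewrite ger0_norm.
  pose A := [set x | C / 2 <= f x].
  have mA : measurable A.
    rewrite (_ : A = f @^-1` `[C / 2, +oo[); last first.
      by apply/seteqP; split => x /=; rewrite in_itv/= andbT.
    by rewrite -[X in measurable X]setTI; apply: bf.1.
  have bA := bounded_measurable_indic _ mA.
  pose h := (- (C / 2)) *: (\1_A : T -> R) + f.
  have -> : e f = e h by rewrite elin// e1// mulr0 add0r.
  rewrite exprS invfM [C * _]mulrA; apply: IH.
    exact: bounded_measurable_lin.
  move=> x; have /andP[f0 fC'] := fC x.
  rewrite (_ : h x = - (C / 2) * (x \in A)%:R + f x)//.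
  have [/set_mem xA|/negP xA] := boolP (x \in A).
    rewrite mulr1; apply/andP; move: xA; rewrite /A/=.
    by split; lra.
  have {}xA : f x < C / 2.
    by rewrite ltNge; apply/negP => ?; apply: xA; exact/mem_set.
  by rewrite mulr0 add0r f0/= ltW.
have pos f C : bounded_measurable f -> (forall x, 0 <= f x <= C) -> e f = 0.
  move=> bf fC; apply/normr0_eq0/le_anti; rewrite normr_ge0 andbT.
  apply/ler_addgt0Pl => eps eps0; rewrite addr0.
  have [KC0|KC0] := lerP (K * C) 0.
    by have := halve 0%N f C bf fC; rewrite expr0 divr1 => /le_trans; apply; lra.
  have [k keps] : exists k : nat, K * C / 2 ^+ k < eps.
    exists (Num.bound (K * C / eps)).
    by rewrite ltr_pdivrMr ?exprn_gt0// -ltr_pdivrMl// mulrC upper_nthrootP.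
  by apply: le_trans (halve k f C bf fC) _; rewrite mulrA ltW.
move=> f bf; have [_ [C fC]] := bf.
have bT := bounded_measurable_indic _ measurableT.
have := elin C \1_setT f bT bf.
rewrite e1// mulr0 add0r => <-; apply: (pos _ (C + C)).
  exact: bounded_measurable_lin.
move=> x; rewrite (_ : (_ + _) x = C * (x \in setT)%:R + f x)// in_setT mulr1.
by have := fC x; rewrite ler_norml => /andP[? ?]; apply/andP; split; lra.
Qed.

Lemma integrable_mul_bounded (mu : {measure set T -> \bar R}) D w f :
  measurable D -> mu.-integrable D (EFin \o w) -> bounded_measurable f ->
  mu.-integrable D (EFin \o (fun x => w x * f x)).
Proof.
move=> mD iw [mf [C fC]].
rewrite (_ : _ \o _ = (EFin \o w) \* (EFin \o f))%E//.
apply: integrableMl => //; first exact: measurable_funTS.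
by exists C; split=> [|M CM x _]; [exact: num_real|exact: le_trans (fC x) (ltW CM)].
Qed.
End bounded_measurable.

(** * The dual of L^1 *)

Section riesz_scalar.
Context {d} {T : measurableType d} {R : realType}.
Variables (mu : {finite_measure set T -> \bar R}) (L : (T -> R) -> R).
Hypothesis L_linear : forall a f g, bounded_measurable f ->
  bounded_measurable g -> L (a *: f + g) = a * L f + L g.
Hypothesis L_dominated : forall f, bounded_measurable f ->
  L f <= \int[mu]_x `|f x|.

Let L0 : L (cst 0) = 0.
Proof.
have b0 := @bounded_measurable_cst d T R 0.
have := L_linear 1 _ _ b0 b0; rewrite (_ : 1 *: cst 0 + cst 0 = cst 0).
  by rewrite mul1r => /eqP; rewrite -subr_eq0 opprD addNKr oppr_eq0 => /eqP.
by apply/funext => x; rewrite /= !fctE scaler0 addr0.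
Qed.

Let normr_L f : bounded_measurable f -> `|L f| <= \int[mu]_x `|f x|.
Proof.
move=> bf; rewrite ler_norml L_dominated// andbT lerNl.
have b0 := @bounded_measurable_cst d T R 0.
have bNf := bounded_measurable_lin (- 1) _ _ bf b0.
have := L_dominated _ bNf; rewrite L_linear// L0 addr0 mulN1r.
move=> /le_trans; apply; rewrite le_eqVlt; apply/orP; left; apply/eqP.
by apply: eq_Rintegral => x _; rewrite /= !fctE addr0 scaleN1r normrN.
Qed.

Let LU (A B : set T) : measurable A -> measurable B -> A `&` B = set0 ->
  L \1_(A `|` B) = L \1_A + L \1_B.
Proof.
move=> mA mB AB; rewrite -[X in _ = X + _]mul1r -L_linear; last 2 first.
- exact: bounded_measurable_indic.
- exact: bounded_measurable_indic.
congr L; apply/funext => x; rewrite [RHS](_ : _ = 1 * (x \in A)%:R + (x \in B)%:R)//.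
rewrite indicE in_setU mul1r.
have [/set_mem xA|_] := boolP (x \in A); last by rewrite add0r.
rewrite [x \in B](_ : _ = false) ?addr0//; apply/negP => /set_mem xB.
by have : (A `&` B) x by []; rewrite AB.
Qed.

Let normr_L_indic A : measurable A -> `|L \1_A| <= fine (mu A).
Proof.
move=> mA; apply: le_trans (normr_L _ (bounded_measurable_indic _ mA)) _.
rewrite -(setIT A) -integral_indic//.
rewrite le_eqVlt; apply/orP; left; apply/eqP.
by apply: eq_Rintegral => x _; rewrite ger0_norm// setIT.
Qed.

Let nu (A : set T) : \bar R := (L \1_A)%:E.

Let nu0 : nu set0 = 0%E.
Proof. by rewrite /nu indic0 L0. Qed.

Let nu_fin A : measurable A -> nu A \is a fin_num.
Proof. by []. Qed.

(** The part of the union left out by finitely many of the sets has small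
    measure, and [|L|] of its indicator is at most this measure. *)
Let nu_sigma_additive : semi_sigma_additive nu.
Proof.
move=> F mF tF mUF.
pose S n := \big[setU/set0]_(i < n) F i.
have mS n : measurable (S n) by exact: bigsetU_measurable.
have nuS n : nu (S n) = (\sum_(0 <= i < n) nu (F i))%E.
  elim: n => [|n IH]; first by rewrite /S big_ord0 big_geq.
  rewrite big_nat_recr//= -IH /S big_ord_recr//= -/(S n) /nu LU ?EFinD//.
  apply: (@trivIset_bigsetUI _ xpredT _ _ n n) => //.
  by apply: sub_trivIset tF => i.
have muS n : mu (S n) = (\sum_(0 <= i < n) mu (F i))%E.
  by rewrite /S measure_bigsetU// big_mkord.
under eq_fun do rewrite -nuS.
have SU n : S n `<=` \bigcup_i F i by rewrite /S; exact: bigsetU_bigcup.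
apply/fine_cvgP; split; first exact: nearW.
apply/cvgrPdist_le => e e0 /=.
have : (mu (S n) @[n --> \oo] --> (fine (mu (\bigcup_n F n)))%:E)%E.
  rewrite fineK ?fin_num_measure//; under eq_fun do rewrite muS.
  exact: measure_semi_sigma_additive.
move=> /fine_cvgP[_].
move=> /cvgrPdist_le/(_ _ e0); apply: filterS => n.
have mSc : measurable (\bigcup_n F n `\` S n) by exact: measurableD.
have UE : \bigcup_n F n = S n `|` (\bigcup_n F n `\` S n) by rewrite setDUK.
move=> h; rewrite {1}UE LU//; last by rewrite setDIK.
rewrite addrAC subrr add0r.
apply: le_trans (normr_L_indic _ mSc) _; apply: le_trans h.
rewrite {2}UE measureU//; last by rewrite setDIK.
rewrite fineD ?fin_num_measure//= addrAC subrr add0r ger0_norm//.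
exact: fine_ge0.
Qed.

HB.instance Definition _ := isCharge.Build _ _ _ nu nu0 nu_fin nu_sigma_additive.

(** The density [w] is the derivative of the charge [A |-> L (\1_A)] with
    respect to [mu]. *)
Lemma riesz_scalar : exists2 w : T -> R, mu.-integrable setT (EFin \o w) &
  forall f, bounded_measurable f -> L f = \int[mu]_x (w x * f x).
Proof.
have numu : nu `<< mu.
  apply/null_content_dominatesP => A mA muA0.
  have := normr_L_indic _ mA; rewrite muA0 normr_le0 => /eqP.
  by rewrite /nu => ->.
pose w x := fine (Radon_Nikodym nu mu x).
have wE : EFin \o w = Radon_Nikodym nu mu.
  by apply/funext => x /=; rewrite fineK// Radon_Nikodym_fin_num.
have iw : mu.-integrable setT (EFin \o w) by rewrite wE; exact: Radon_Nikodym_integrable.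
exists w => // f bf; apply/eqP; rewrite -subr_eq0; apply/eqP; move: f bf.
apply: (@bounded_measurable_linear_eq0 _ _ _ (fun f => L f - _)
   (fine (mu setT) + \int[mu]_x `|w x|)).
- move=> a f g bf bg; rewrite L_linear//.
  have := Rintegral_linear mu setT a (fun x => w x * f x) (fun x => w x * g x).
  under eq_Rintegral do rewrite mulrCA -mulrDr.
  by move=> ->//; [ring|exact: integrable_mul_bounded..].
- move=> A mA; apply/eqP; rewrite subr_eq0; apply/eqP.
  rewrite [LHS](_ : _ = fine (nu A))// (Radon_Nikodym_integral numu mA).
  rewrite integral_mkcond; congr fine; apply: eq_integral => x _.
  rewrite -wE /patch /= indicE; case: ifPn => _; first by rewrite mulr1.
  by rewrite mulr0.
- move=> f C bf fC; rewrite (le_trans (ler_normB _ _))// mulrDl lerD//.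
    apply: le_trans (normr_L _ bf) _; rewrite mulrC -Rintegral_cst//.
    apply: le_Rintegral => //.
      by apply: bounded_measurable_integrable => //; exact: bounded_measurable_norm.
    by apply: bounded_measurable_integrable => //; exact: bounded_measurable_cst.
  have iwf := integrable_mul_bounded _ _ _ _ measurableT iw bf.
  apply: le_trans (le_normr_Rintegral measurableT iwf) _.
  rewrite -RintegralZr//; last exact: integrable_norm.
  apply: le_Rintegral => //; first exact: integrable_norm.
    apply: integrable_mul_bounded => //; first exact: integrable_norm.
    exact: bounded_measurable_cst.
  by move=> x _; rewrite normrM ler_wpM2l.
Qed.
End riesz_scalar.

Section riesz_vector.
Context {d} {T : measurableType d} {R : realType} {n : nat}.
Implicit Types F G : T -> 'rV[R]_n.

Definition bounded_measurable_field F :=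
  forall i, bounded_measurable (fun x => F x 0 i).

Lemma bounded_measurable_field_lin a F G : bounded_measurable_field F ->
  bounded_measurable_field G -> bounded_measurable_field (a *: F + G).
Proof.
move=> bF bG i; rewrite (_ : (fun x => _) =
    a *: (fun x => F x 0 i) + (fun x => G x 0 i)).
  exact: bounded_measurable_lin.
by apply/funext => x; rewrite !mxE.
Qed.

Lemma bounded_measurable_field_cst (v : 'rV[R]_n) :
  bounded_measurable_field (cst v).
Proof. by move=> i; exact: bounded_measurable_cst. Qed.

Lemma bounded_measurable_enorm F : bounded_measurable_field F ->
  bounded_measurable (fun x => enorm (F x)).
Proof.
move=> bF; split; first by apply: measurable_enorm => i; exact: (bF i).1.
have /choice[C FC] : forall i, exists C, forall x, `|F x 0 i| <= C.
  by move=> i; exact: (bF i).2.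
exists (\sum_i C i) => x; rewrite ger0_norm ?enorm_ge0//.
by rewrite (le_trans (enorm_le_sum _))// ler_sum.
Qed.

Lemma bounded_measurable_field_scale f i : bounded_measurable f ->
  bounded_measurable_field (fun x => f x *: delta_mx 0 i).
Proof.
move=> bf j; set c := (delta_mx 0 i : 'rV[R]_n) 0 j.
have -> : (fun x => (f x *: delta_mx 0 i : 'rV[R]_n) 0 j) = f \* cst c.
  by apply/funext => x; rewrite mxE.
by apply: bounded_measurableM => //; exact: bounded_measurable_cst.
Qed.

Variables (mu : {finite_measure set T -> \bar R}).
Variables (L : (T -> 'rV[R]_n) -> R).
Hypothesis L_linear : forall a F G, bounded_measurable_field F ->
  bounded_measurable_field G -> L (a *: F + G) = a * L F + L G.
Hypothesis L_dominated : forall F, bounded_measurable_field F ->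
  L F <= \int[mu]_x enorm (F x).

(** The components of the density represent the restrictions of [L] to the
    fields parallel to the coordinate axes. *)
Let density : exists2 w : 'I_n -> T -> R,
  forall i, mu.-integrable setT (EFin \o w i) &
  forall F, bounded_measurable_field F ->
    mu.-integrable setT (EFin \o (fun x => edot (\row_i w i x) (F x))) /\
    L F = \int[mu]_x edot (\row_i w i x) (F x).
Proof.
have L_delta_lin i a f g : bounded_measurable f -> bounded_measurable g ->
    L (fun x => (a *: f + g) x *: delta_mx 0 i) =
    a * L (fun x => f x *: delta_mx 0 i) + L (fun x => g x *: delta_mx 0 i).
  move=> bf bg; rewrite -L_linear; last 2 first.
  - exact: bounded_measurable_field_scale.
  - exact: bounded_measurable_field_scale.
  by congr L; apply/funext => x; rewrite !fctE scalerDl scalerA.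
have L_delta_dom i f : bounded_measurable f ->
    L (fun x => f x *: delta_mx 0 i) <= \int[mu]_x `|f x|.
  move=> bf; have h := L_dominated _ (bounded_measurable_field_scale _ i bf).
  apply: (le_trans h).
  rewrite le_eqVlt; apply/orP; left; apply/eqP.
  by apply: eq_Rintegral => x _; rewrite enormZ enorm_delta mulr1.
have /choice[w wP] : forall i, exists w : T -> R, mu.-integrable setT (EFin \o w)
    /\ forall f, bounded_measurable f ->
      L (fun x => f x *: delta_mx 0 i) = \int[mu]_x (w x * f x).
  move=> i; have [w iw wP] := riesz_scalar _ _ (L_delta_lin i) (L_delta_dom i).
  by exists w.
exists w => [i|F bF]; first by have [] := wP i.
have L0 : L (cst 0) = 0.
  have b0 := bounded_measurable_field_cst 0.
  have := L_linear 1 _ _ b0 b0; rewrite (_ : 1 *: cst 0 + cst 0 = cst 0).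
    by rewrite mul1r => /eqP; rewrite -subr_eq0 opprD addNKr oppr_eq0 => /eqP.
  by apply/funext => x; rewrite /= !fctE scaler0 addr0.
have iwF i : mu.-integrable setT (EFin \o (fun x => w i x * F x 0 i)).
  by apply: integrable_mul_bounded => //; exact: (wP i).1.
have FE s : [/\ L (fun x => \sum_(i <- s) F x 0 i *: delta_mx 0 i) =
      \int[mu]_x (\sum_(i <- s) (w i x * F x 0 i)),
    mu.-integrable setT (EFin \o (fun x => \sum_(i <- s) (w i x * F x 0 i))) &
    bounded_measurable_field (fun x => \sum_(i <- s) F x 0 i *: delta_mx 0 i)].
  elim: s => [|i s [IH iws bs]].
    under eq_fun do rewrite big_nil; under eq_Rintegral do rewrite big_nil.
    split => //; last exact: bounded_measurable_field_cst.
      by rewrite Rintegral_cst// mul0r.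
    rewrite (_ : _ \o _ = cst 0%E); first exact: integrable0.
    by apply/funext => x; rewrite /= big_nil.
  have bi := bounded_measurable_field_scale _ i (bF i).
  rewrite (_ : (fun x => _) = 1 *: (fun x => F x 0 i *: delta_mx 0 i) +
     (fun x => \sum_(i <- s) F x 0 i *: delta_mx 0 i)); last first.
    by apply/funext => x; rewrite big_cons !fctE scale1r.
  split; last exact: bounded_measurable_field_lin.
    rewrite L_linear// mul1r IH (wP i).2// -RintegralD//.
    by apply: eq_Rintegral => x _; rewrite big_cons.
  rewrite (_ : _ \o _ = (fun x => EFin (w i x * F x 0 i)%R +
      EFin (\sum_(i <- s) (w i x * F x 0 i))%R)%E).
    exact: (integrableD measurableT (iwF i) iws).
  by apply/funext => x; rewrite /= big_cons EFinD.
have [FL Fi _] := FE (enum 'I_n).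
have wE : (fun x => edot (\row_i w i x) (F x)) =
    (fun x => \sum_(i <- enum 'I_n) (w i x * F x 0 i)).
  by apply/funext => x; rewrite big_enum/=; apply: eq_bigr => i _; rewrite mxE.
rewrite wE; split => //; rewrite -FL; congr L.
by apply/funext => x; rewrite big_enum/= -row_sum_delta.
Qed.

(** Let [A] be the set where the density [z0] has norm larger than [1]. Testing
    [L] with the field [\1_A z0 / |z0|] gives
      [\int_A |z0| <= \int_A 1],
    so that [A] is a null set, on which [z0] can be replaced by [0]. *)
Lemma riesz_L1_dual : exists z : T -> 'rV[R]_n,
  [/\ forall i, measurable_fun setT (fun x => z x 0 i),
      forall x, enorm (z x) <= 1
    & forall F, bounded_measurable_field F ->
        L F = \int[mu]_x edot (z x) (F x)].
Proof.
have [w iw wP] := density.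
pose z0 x : 'rV[R]_n := \row_i w i x.
have mw i : measurable_fun setT (w i).
  by apply/measurable_EFinP; exact: measurable_int (iw i).
have mz0 i : measurable_fun setT (fun x => z0 x 0 i).
  by rewrite (_ : (fun x => _) = w i)//; apply/funext => x; rewrite mxE.
have mN := measurable_enorm setT z0 mz0.
pose A := [set x | 1 < enorm (z0 x)].
have mA : measurable A.
  rewrite (_ : A = (fun x => enorm (z0 x)) @^-1` `]1, +oo[).
    by rewrite -[X in measurable X]setTI; exact: mN.
  by apply/seteqP; split => x; rewrite /= in_itv/= andbT.
have bA := bounded_measurable_indic (R := R) A mA.
pose F x := (\1_A x * (enorm (z0 x))^-1) *: z0 x.
have bF : bounded_measurable_field F.
  move=> i; rewrite /F; split.
    under eq_fun do rewrite mxE -powR_inv1 ?enorm_ge0//.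
    apply: measurable_funM => //; apply: measurable_funM => //.
    exact: (@measurableT_comp _ _ _ _ _ _ (@powR R ^~ (- 1))).
  exists 1 => x; rewrite mxE indicE; have [/set_mem|_] := boolP (x \in A); last first.
    by rewrite !mul0r normr0.
  rewrite /A/= mul1r => zx; rewrite normrM ger0_norm ?invr_ge0 ?enorm_ge0//.
  by rewrite ler_pdivrMl ?(lt_trans ltr01)// mulr1 coord_le_enorm.
have Fz x : edot (z0 x) (F x) = \1_A x * enorm (z0 x).
  rewrite /F edotZr -sqr_enorm indicE; have [/set_mem|_] := boolP (x \in A); last first.
    by rewrite !mul0r.
  rewrite /A/= => zx; rewrite !mul1r expr2 mulrA mulVf ?mul1r//.
  by rewrite gt_eqF// (lt_trans ltr01).
have NF x : enorm (F x) = \1_A x.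
  rewrite /F enormZ indicE; have [/set_mem|_] := boolP (x \in A); last first.
    by rewrite mul0r normr0 mul0r.
  rewrite /A/= => zx; rewrite mul1r ger0_norm ?invr_ge0 ?enorm_ge0// mulVf//.
  by rewrite gt_eqF// (lt_trans ltr01).
have [iN LF] := wP _ bF.
rewrite (_ : (fun x => _) = (fun x => \1_A x * enorm (z0 x))) in iN; last first.
  by apply/funext => x; exact: Fz.
have i1 : mu.-integrable setT (EFin \o (\1_A : T -> R)).
  exact: bounded_measurable_integrable.
pose h x := \1_A x * enorm (z0 x) - \1_A x.
have h0 x : 0 <= h x.
  rewrite /h indicE; have [/set_mem|_] := boolP (x \in A); last by rewrite mul0r subr0.
  by rewrite /A/= mul1r subr_ge0 => /ltW.
have ih : mu.-integrable setT (EFin \o h).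
  exact: (integrableB measurableT iN i1).
have inth : \int[mu]_x h x <= 0.
  rewrite RintegralB// subr_le0.
  have := L_dominated _ bF; rewrite LF; under eq_Rintegral do rewrite Fz.
  by under [X in _ <= X -> _]eq_Rintegral do rewrite NF.
have muA : mu A = 0%E.
  have : (\int[mu]_x `|(h x)%:E| = 0)%E.
    rewrite (_ : (fun x => _) = EFin \o h); last first.
      by apply/funext => x; rewrite gee0_abs// lee_fin.
    apply/eqP; rewrite eq_le integral_ge0 ?andbT//; last by move=> x _; rewrite lee_fin.
    rewrite -(@fineK _ (\int[mu]_x (EFin \o h) x))%E ?lee_fin//.
    exact: integrable_fin_num.
  move/(ae_eq_integral_abs mu measurableT (measurable_int _ ih)) => h_ae0.
  apply/negligibleP => //; apply: negligibleS h_ae0 => x Ax /= /(_ I) [].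
  rewrite /h indicE mem_set// mul1r => /eqP; rewrite subr_eq0 => /eqP zx.
  by move: Ax; rewrite /A/= zx ltxx.
pose z x := \1_(~` A) x *: z0 x.
have mz i : measurable_fun setT (fun x => z x 0 i).
  under eq_fun do rewrite mxE.
  by apply: measurable_funM => //; apply: measurable_indic; exact: measurableC.
exists z; split => //.
- move=> x; rewrite /z indicE; have [/set_mem|_] := boolP (x \in ~` A).
    by rewrite scale1r /A/= => /negP; rewrite -leNgt.
  by rewrite enormZ normr0 mul0r.
- move=> G bG; rewrite (wP _ bG).2; congr fine; apply: ae_eq_integral => //.
  + exact: measurable_int (wP _ bG).1.
  + by apply/measurable_EFinP; apply: measurable_edot => // i; exact: (bG i).1.
  exists A; split => // x /= /not_implyP[_] zx; apply: contrapT => nAx.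
  by apply: zx; rewrite /z indicE mem_set// scale1r.
Qed.

End riesz_vector.

(** * Slicing R^n *)

Section lebesgue_rV_tonelli.
Context {R : realType} {n : nat}.
Local Open Scope ereal_scope.
Variable f : 'rV[R]_n.+1 -> \bar R.
Hypotheses (mf : measurable_fun setT f) (f0 : forall x, 0 <= f x).

Let integral_cons : \int[lebesgue_rV n.+1]_x f x =
  \int[@lebesgue_measure R \x @lebesgue_rV R n]_p f (cons_rV p).
Proof.
have mc : measurable_fun [set: measurableTypeR R * 'rV[R]_n] (@cons_rV R n).
  exact: measurable_cons_rV.
have := @ge0_integral_pushforward _ _ _ _ R _ mc
  (@lebesgue_measure R \x @lebesgue_rV R n) setT f measurableT mf.
rewrite preimage_setT => <-; last by move=> y _; exact: f0.
exact: eq_measure_integral.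
Qed.

Let mfc : measurable_fun setT (fun p : measurableTypeR R * 'rV[R]_n => f (cons_rV p)).
Proof. exact: measurableT_comp mf (@measurable_cons_rV R n). Qed.

Lemma measurable_integral_rV_fst :
  measurable_fun setT (fun y => \int[@lebesgue_measure R]_t f (cons_rV (t, y))).
Proof. exact: (measurable_fun_fubini_tonelli_G _ mfc). Qed.

Lemma measurable_integral_rV_snd :
  measurable_fun setT (fun t => \int[@lebesgue_rV R n]_y f (cons_rV (t, y))).
Proof. exact: (measurable_fun_fubini_tonelli_F _ mfc). Qed.

Lemma integral_rVS1 : \int[lebesgue_rV n.+1]_x f x =
  \int[@lebesgue_measure R]_t \int[lebesgue_rV n]_y f (cons_rV (t, y)).
Proof. by rewrite integral_cons fubini_tonelli1. Qed.

Lemma integral_rVS2 : \int[lebesgue_rV n.+1]_x f x =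
  \int[lebesgue_rV n]_y \int[@lebesgue_measure R]_t f (cons_rV (t, y)).
Proof. by rewrite integral_cons fubini_tonelli2. Qed.

End lebesgue_rV_tonelli.

Section cons_rV_slices.
Context {R : realType} {n : nat}.
Implicit Types (t h : R) (y : 'rV[R]_n) (phi : 'rV[R]_n.+1 -> R).

Lemma cons_rVDl t h y :
  h *: delta_mx 0 0 + cons_rV (t, y) = cons_rV (h *: (1 : R) + t, y).
Proof.
apply/rowP => j; rewrite !mxE; case: unliftP => [k ->|->] /=.
  by rewrite mulr0 add0r.
by [].
Qed.

Lemma cons_rVDr t h i y :
  h *: delta_mx 0 (lift 0 i) + cons_rV (t, y) =
  cons_rV (t, h *: delta_mx 0 i + y).
Proof.
apply/rowP => j; rewrite !mxE; case: unliftP => [k ->|->] /=.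
  by rewrite !mxE (inj_eq lift_inj).
by rewrite mulr0 add0r.
Qed.

Lemma continuous_cons_rVr t : continuous (fun y => cons_rV (t, y)).
Proof.
move=> y U /nbhs_ballP[e /= e0 eU]; apply/nbhs_ballP; exists e => //= y' [_ yy'].
apply: eU; split => // i j.
rewrite !mxE; case: unliftP => [k _|_] /=; last exact: ballxx.
exact: yy'.
Qed.

Lemma continuous_cons_rVl y : continuous (fun t => cons_rV (t, y)).
Proof.
move=> t U /nbhs_ballP[e /= e0 eU]; apply/nbhs_ballP; exists e => //= t' tt'.
apply: eU; split => // i j.
by rewrite !mxE; case: unliftP => [k _|_] //=; exact: ballxx.
Qed.

Lemma pderiv_slice phi t i : pderiv i (fun y => phi (cons_rV (t, y))) =
  (fun y => pderiv (lift 0 i) phi (cons_rV (t, y))).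
Proof.
apply/funext => y; rewrite /pderiv /derive.
by under eq_fun do rewrite /= -cons_rVDr.
Qed.

Lemma derivable_slice phi t y i :
  derivable phi (cons_rV (t, y)) (delta_mx 0 (lift 0 i)) ->
  derivable (fun y => phi (cons_rV (t, y))) y (delta_mx 0 i).
Proof.
by rewrite /derivable; under eq_fun do rewrite /= cons_rVDr.
Qed.

Lemma derive_slice phi t y :
  'D_1 (fun t => phi (cons_rV (t, y))) t = pderiv 0 phi (cons_rV (t, y)).
Proof.
rewrite /pderiv /derive.
by under [in RHS]eq_fun do rewrite /= cons_rVDl.
Qed.

Lemma derivable_line phi t y : derivable phi (cons_rV (t, y)) (delta_mx 0 0) ->
  derivable (fun t => phi (cons_rV (t, y))) t 1.
Proof.
rewrite /derivable.
by under eq_fun do rewrite /= cons_rVDl.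
Qed.

End cons_rV_slices.

Section C1_compact.
Context {R : realType}.

Lemma continuous_measurable_rV n (f : 'rV[R]_n -> R) :
  continuous f -> measurable_fun setT f.
Proof.
move=> cf; apply: (measurability _ (RGenOpens.measurableE R)) => _ [_ [a [b ->]] <-].
rewrite setTI; apply: open_measurable_rV.
by apply: open_comp => [v _|]; [exact: cf|exact: interval_open].
Qed.

Lemma continuous_slice n (f : 'rV[R]_n.+1 -> R) t : continuous f ->
  continuous (fun y => f (cons_rV (t, y))).
Proof.
move=> cf y.
apply: (@continuous_comp _ _ _ (fun y => cons_rV (t, y)) f); last exact: cf.
exact: continuous_cons_rVr.
Qed.

Lemma continuous_line n (f : 'rV[R]_n.+1 -> R) y : continuous f ->
  continuous (fun t => f (cons_rV (t, y))).
Proof.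
move=> cf t.
apply: (@continuous_comp _ _ _ (fun t => cons_rV (t, y)) f); last exact: cf.
exact: continuous_cons_rVl.
Qed.

(** The support is confined to a cube, rather than to a compact set, because
    slices inherit this bound at once. *)
Definition C1_compact {n} (phi : 'rV[R]_n -> R) :=
  [/\ continuous phi, forall i x, derivable phi x (delta_mx 0 i),
      forall i, continuous (pderiv i phi)
    & exists M : R, forall (x : 'rV[R]_n) j, M < `|x 0 j| -> phi x = 0].

Lemma pderiv_near0 n (phi : 'rV[R]_n -> R) i x :
  (\forall y \near x, phi y = 0) -> pderiv i phi x = 0.
Proof.
move=> h; rewrite /pderiv (near_eq_derive (g := cst 0))//.
exact: derive_cst.
Qed.

Lemma C1_compact_slice n (phi : 'rV[R]_n.+1 -> R) t : C1_compact phi ->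
  C1_compact (fun y => phi (cons_rV (t, y))).
Proof.
move=> [cphi dphi cdphi [M phiM]]; split.
- exact: continuous_slice.
- by move=> i y; exact: derivable_slice.
- by move=> i; rewrite pderiv_slice; exact: continuous_slice (cdphi _).
- exists M => y j My; apply: (phiM _ (lift 0 j)).
  by rewrite mxE liftK.
Qed.

Lemma integral_compact_support_lty (c : R -> R) M : continuous c ->
  (forall s, M < `|s| -> c s = 0) ->
  (\int[@lebesgue_measure R]_s `|c s|%:E < +oo)%E.
Proof.
move=> cc cM.
have ic : (@lebesgue_measure R).-integrable `[- M, M] (EFin \o c).
  apply: continuous_compact_integrable; first exact: segment_compact.
  by apply: continuous_subspaceT.
have /integrableP[_] := ic; congr (_ < _)%E.
rewrite [LHS]integral_mkcond; apply: eq_integral => s _.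
rewrite /patch; case: ifPn => // /negP sM.
rewrite cM ?normr0// ltNge; apply/negP; rewrite ler_norml => sM'.
by apply: sM; rewrite inE /= in_itv.
Qed.

(** Integrate [psi^`()] from a point to the left of the support of [psi]. *)
Lemma le_norm_integral_deriv (psi : R -> R) M t :
  (forall s, derivable psi s 1) -> continuous psi ->
  continuous (fun s => 'D_1 psi s) -> (forall s, M < `|s| -> psi s = 0) ->
  (`|psi t|%:E <= \int[@lebesgue_measure R]_s `|'D_1 psi s|%:E)%E.
Proof.
move=> dpsi cpsi cdpsi psiM.
pose a := - (`|M| + 1 + `|t|).
have at_ : a < t.
  by rewrite /a; have := ler_norm (- t); rewrite normrN; have := normr_ge0 M; lra.
have pa : psi a = 0.
  apply: psiM; rewrite /a normrN ger0_norm; last by rewrite !addr_ge0.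
  by have := ler_norm M; have := normr_ge0 t; lra.
have := @continuous_FTC2 R (fun s => 'D_1 psi s) psi a t at_.
rewrite -abse_EFin pa sube0 => <-.
- apply: le_trans (le_abse_integral _ _ _) _ => //.
    apply/measurable_EFinP; apply: measurable_funTS.
    exact: continuous_measurable_fun.
  apply: ge0_subset_integral => //.
  apply/measurable_EFinP; apply: measurableT_comp => //.
  exact: continuous_measurable_fun.
- exact: continuous_subspaceT.
- split; first by move=> s _.
  + by apply: cvg_at_right_filter; exact: cpsi.
  + by apply: cvg_at_left_filter; exact: cpsi.
- by move=> s _; rewrite derive1E.
Qed.

Lemma C1_compact_line_le n (phi : 'rV[R]_n.+1 -> R) t y : C1_compact phi ->
  (`|phi (cons_rV (t, y))|%:E <=
   \int[@lebesgue_measure R]_s `|pderiv 0 phi (cons_rV (s, y))|%:E)%E.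
Proof.
move=> [cphi dphi cdphi [M phiM]].
pose psi s := phi (cons_rV (s, y)).
have dE s : 'D_1 psi s = pderiv 0 phi (cons_rV (s, y)) by exact: derive_slice.
under eq_integral do rewrite -dE.
apply: (@le_norm_integral_deriv psi M).
- by move=> s; exact: derivable_line.
- exact: continuous_line.
- by under eq_fun do rewrite dE; exact: continuous_line (cdphi _).
- by move=> s Ms; apply: (phiM _ 0); rewrite mxE unlift_none.
Qed.

(** Finiteness lets the integral along a line be used as a real-valued weight in
    the induction on the dimension. *)
Lemma C1_compact_line_lty n (phi : 'rV[R]_n.+1 -> R) y : C1_compact phi ->
  (\int[@lebesgue_measure R]_s `|pderiv 0 phi (cons_rV (s, y))|%:E < +oo)%E.
Proof.
move=> [cphi dphi cdphi [M phiM]].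
apply: (@integral_compact_support_lty _ M).
  exact: continuous_line (cdphi _).
move=> s Ms; apply: pderiv_near0.
have cz : continuous (fun z : 'rV[R]_n.+1 => `|z 0 0| : R).
  move=> z.
  apply: (@continuous_comp _ _ _ (fun z : 'rV[R]_n.+1 => z 0 0) (fun r : R => `|r|)).
    exact: coord_continuous.
  exact: norm_continuous.
have := @cvgr_gt _ _ _ _ _ _ (cz (cons_rV (s, y))) M.
rewrite mxE unlift_none => /(_ (nbhs_filter _) Ms); apply: filterS => z Mz.
exact: (phiM _ 0).
Qed.

End C1_compact.

(** * The Gagliardo-Nirenberg-Sobolev inequality *)

Section gagliardo_nirenberg.
Context {R : realType}.

Lemma uncons_rVK n : cancel (@uncons_rV R n) (@cons_rV R n).
Proof.
move=> x; apply/rowP => j; rewrite !mxE; case: unliftP => [k ->|->] //=.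
by rewrite mxE.
Qed.

Lemma grad_enorm_slice n (phi : 'rV[R]_n.+1 -> R) t y :
  enorm (grad (fun y => phi (cons_rV (t, y))) y) <= enorm (grad phi (cons_rV (t, y))).
Proof.
rewrite ler_wsqrtr// /edot big_ord_recl !mxE -expr2.
set gs := grad _ y.
rewrite [leRHS](_ : _ = (pderiv 0 phi (cons_rV (t, y))) ^+ 2 + edot gs gs).
  by rewrite lerDr sqr_ge0.
by congr (_ + _); apply: eq_bigr => i _; rewrite !mxE pderiv_slice.
Qed.

Lemma measurable_enorm_grad n (phi : 'rV[R]_n -> R) : C1_compact phi ->
  measurable_fun setT (fun x => (enorm (grad phi x))%:E).
Proof.
move=> [_ _ cdphi _]; apply/measurable_EFinP; apply: measurable_enorm => i.
by under eq_fun do rewrite mxE; exact: continuous_measurable_rV.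
Qed.

Lemma pderiv_le_enorm_grad n (phi : 'rV[R]_n -> R) i x :
  `|pderiv i phi x| <= enorm (grad phi x).
Proof. by have := coord_le_enorm (grad phi x) i; rewrite mxE. Qed.

Lemma measurable_line n (y : 'rV[R]_n) :
  measurable_fun setT (fun t : measurableTypeR R => cons_rV (t, y)).
Proof.
apply: measurable_fun_rV => j; apply: continuous_measurable_fun.
apply: (continuous_line _ (fun x : 'rV[R]_n.+1 => x 0 j)) => x.
exact: coord_continuous.
Qed.

Lemma measurable_slice n (t : R) :
  measurable_fun setT (fun y : 'rV[R]_n => cons_rV (t, y)).
Proof.
apply: measurable_fun_rV => j; apply: continuous_measurable_rV.
apply: (continuous_slice _ (fun x : 'rV[R]_n.+1 => x 0 j)) => x.
exact: coord_continuous.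
Qed.

Local Open Scope ereal_scope.
Local Notation energy phi := (\int[lebesgue_rV _]_x (enorm (grad phi x))%:E).

(** In dimension [1] a compactly supported function is bounded by the integral
    of the modulus of its derivative. *)
Lemma sup_le_energy1 (phi : 'rV[R]_1 -> R) x : C1_compact phi ->
  `|phi x|%:E <= energy phi.
Proof.
move=> cphi; rewrite -(uncons_rVK _ x); case: (uncons_rV x) => t y.
rewrite (thinmx0 y).
apply: le_trans (C1_compact_line_le _ _ t 0%R cphi) _.
have m := measurable_enorm_grad _ _ cphi.
have e0 z : 0 <= (enorm (grad phi z))%:E by rewrite lee_fin enorm_ge0.
rewrite (integral_rVS2 _ m e0).
rewrite [leRHS]integral_dirac//; last exact: (measurable_integral_rV_fst _ m e0).
rewrite diracT mul1e; apply: ge0_le_integral => //.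
- apply/measurable_EFinP; apply: measurableT_comp => //.
  by apply: continuous_measurable_fun; apply: continuous_line; case: cphi.
- exact: measurableT_comp m (measurable_line _ _).
- by move=> s _; rewrite lee_fin pderiv_le_enorm_grad.
Qed.

(** The passage from dimension [m = n.+1] to [m.+1]. With
    [F y = \int |d_t phi (s, y)| ds] and [G = F^(1/m)] one has
    [|phi (t, y)|^(1 + 1/m) <= G y |phi (t, y)|]. For fixed [t] the inequality in
    dimension [m] bounds the integral over [y] by the [L^m] norm of [G], which
    is [(\int F)^(1/m)], times the energy of the slice; now integrate in
    [t]. *)
Lemma integral_powR_le_energy n (phi : 'rV[R]_n.+2 -> R) : C1_compact phi ->
  (forall (psi : 'rV[R]_n.+1 -> R) (g : 'rV[R]_n.+1 -> R),
     C1_compact psi -> measurable_fun setT g ->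
     \int[lebesgue_rV _]_x `|g x * psi x|%:E <=
     'N[lebesgue_rV n.+1]_(n.+1%:R%:E)[EFin \o g] * energy psi) ->
  \int[lebesgue_rV _]_x (`|phi x| `^ (1 + n.+1%:R^-1))%:E <=
    energy phi `^ (1 + n.+1%:R^-1).
Proof.
move=> cphi IH; set m := n.+1; set a := (m%:R^-1 : R)%R.
have a0 : (0 < a)%R by rewrite invr_gt0 ltr0n.
have menergy := measurable_enorm_grad _ _ cphi.
have e0 z : 0 <= (enorm (grad phi z))%:E by rewrite lee_fin enorm_ge0.
have energy0 : 0 <= energy phi by exact: integral_ge0.
have [ccphi _ cdphi _] := cphi.
have mphi := continuous_measurable_rV _ _ ccphi.
have md0 : measurable_fun setT (fun x => `|pderiv 0 phi x|%:E).
  apply/measurable_EFinP; apply: measurableT_comp => //.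
  exact: continuous_measurable_rV.
have d00 x : 0 <= `|pderiv 0 phi x|%:E by rewrite lee_fin.
pose FE y := \int[@lebesgue_measure R]_s `|pderiv 0 phi (cons_rV (s, y))|%:E.
pose F y := fine (FE y).
have FE0 y : 0 <= FE y by apply: integral_ge0 => s _.
have FEE y : FE y = (F y)%:E.
  by rewrite fineK// ge0_fin_numE//; exact: C1_compact_line_lty.
have F0 y : (0 <= F y)%R by rewrite fine_ge0.
have mFE : measurable_fun setT FE by exact: (measurable_integral_rV_fst _ md0 d00).
have mF : measurable_fun setT F by exact: measurableT_comp.
have intF : \int[lebesgue_rV m]_y (F y)%:E <= energy phi.
  under eq_integral do rewrite -FEE.
  rewrite -(integral_rVS2 _ md0 d00); apply: ge0_le_integral => // x _.
  by rewrite lee_fin pderiv_le_enorm_grad.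
pose G y := (F y `^ a)%R.
have G0 y : (0 <= G y)%R by exact: powR_ge0.
have mG : measurable_fun setT G.
  exact: (@measurableT_comp _ _ _ _ _ _ (@powR R ^~ a)).
have normG : 'N[lebesgue_rV m]_(m%:R%:E)[EFin \o G] <= energy phi `^ a.
  rewrite unlock; apply: gt0_ler_poweR; first exact: ltW.
  - rewrite in_itv/= leey andbT; apply: integral_ge0 => y _.
    by rewrite lee_fin powR_ge0.
  - by rewrite in_itv/= leey andbT.
  apply: le_trans intF; rewrite le_eqVlt; apply/orP; left; apply/eqP.
  apply: eq_integral => y _ /=; rewrite ger0_norm// /G -powRrM mulVf ?powRr1//.
  by rewrite pnatr_eq0.
have phiF t y : (`|phi (cons_rV (t, y))| <= F y)%R.
  by rewrite -lee_fin -FEE; exact: C1_compact_line_le.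
have pow_le t y : (`|phi (cons_rV (t, y))| `^ (1 + a) <=
    `|G y * phi (cons_rV (t, y))|)%R.
  rewrite powRD; last by rewrite gt_eqF// addr_gt0.
  rewrite powRr1// normrM mulrC (ger0_norm (G0 y)).
  by rewrite ler_wpM2r// ge0_ler_powR ?nnegrE// ltW.
have mpow : measurable_fun setT (fun x => (`|phi x| `^ (1 + a))%:E).
  apply/measurable_EFinP.
  apply: (@measurableT_comp _ _ _ _ _ _ (@powR R ^~ (1 + a)%R)) => //.
  exact: measurableT_comp.
have pow0 x : 0 <= (`|phi x| `^ (1 + a))%:E by rewrite lee_fin powR_ge0.
have slice t : \int[lebesgue_rV m]_y (`|phi (cons_rV (t, y))| `^ (1 + a))%:E <=
    energy phi `^ a * \int[lebesgue_rV m]_y (enorm (grad phi (cons_rV (t, y))))%:E.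
  apply: (@le_trans _ _ (\int[lebesgue_rV m]_y `|G y * phi (cons_rV (t, y))|%:E)).
    apply: ge0_le_integral => //.
    - exact: measurableT_comp mpow (measurable_slice _ _).
    - apply/measurable_EFinP; apply: measurableT_comp => //.
      apply: measurable_funM => //.
      exact: measurableT_comp mphi (measurable_slice _ _).
    - by move=> y _; rewrite lee_fin.
  apply: le_trans (IH _ _ (C1_compact_slice _ _ t cphi) mG) _.
  apply: lee_pmul => //; first exact: Lnorm_ge0.
    by apply: integral_ge0 => y _; rewrite lee_fin enorm_ge0.
  apply: ge0_le_integral => //.
  - by move=> y _; rewrite lee_fin enorm_ge0.
  - exact: measurable_enorm_grad (C1_compact_slice _ _ t cphi).
  - exact: measurableT_comp menergy (measurable_slice _ _).
  - by move=> y _; rewrite lee_fin grad_enorm_slice.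
have -> : energy phi `^ (1 + a) = energy phi `^ a * energy phi.
  rewrite addrC poweRD ?poweRe1//.
  by apply: add_neq0_poweRD_def; rewrite gt_eqF// addr_gt0.
rewrite (integral_rVS1 _ mpow pow0) {2}(integral_rVS1 _ menergy e0).
rewrite -ge0_integralZl//; last 3 first.
- exact: (measurable_integral_rV_snd _ menergy e0).
- by move=> t _; apply: integral_ge0 => y _; rewrite lee_fin enorm_ge0.
- exact: poweR_ge0.
apply: ge0_le_integral => //.
- by move=> t _; apply: integral_ge0 => y _; exact: pow0.
- exact: (measurable_integral_rV_snd _ mpow pow0).
- apply: emeasurable_funM => //.
  exact: (measurable_integral_rV_snd _ menergy e0).
Qed.

(** In dimension [N] this is, by duality, the bound of the [L^(N/(N-1))] norm of
    [phi] by the [L^1] norm of its gradient. It also makes sense for [N = 1],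
    where the former is the supremum norm. *)
Theorem gagliardo_nirenberg n (phi : 'rV[R]_n.+1 -> R) (g : 'rV[R]_n.+1 -> R) :
  C1_compact phi -> measurable_fun setT g ->
  \int[lebesgue_rV _]_x `|g x * phi x|%:E <=
  'N[lebesgue_rV n.+1]_(n.+1%:R%:E)[EFin \o g] * energy phi.
Proof.
elim: n phi g => [|n IH] phi g cphi mg.
  rewrite Lnorm1 -ge0_integralZr//; last 2 first.
  - by apply/measurableT_comp => //; exact/measurable_EFinP.
  - by apply: integral_ge0 => x _; rewrite lee_fin enorm_ge0.
  apply: ge0_le_integral => //.
  - apply/measurable_EFinP; apply: measurableT_comp => //.
    apply: measurable_funM => //.
    by apply: continuous_measurable_rV; case: cphi.
  - apply: emeasurable_funM => //.
    by apply: measurableT_comp => //; exact/measurable_EFinP.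
  - by move=> x _; rewrite normrM EFinM lee_wpmul2l// sup_le_energy1.
have mphi : measurable_fun setT phi by apply: continuous_measurable_rV; case: cphi.
set p := (n.+2%:R : R)%R; set q := (1 + n.+1%:R^-1 : R)%R.
have p0 : (0 < p)%R by rewrite ltr0n.
have q0 : (0 < q)%R by rewrite addr_gt0// invr_gt0 ltr0n.
have pq : (p^-1 + q^-1 = 1 :> R)%R.
  rewrite /p /q -natr1; field.
  by rewrite [(1 + _)%R]addrC !natr1 !pnatr_eq0.
have := @hoelder _ _ _ (lebesgue_rV n.+2) g phi p q mg mphi p0 q0 pq.
rewrite Lnorm1 => /le_trans; apply; apply: lee_wpmul2l; first exact: Lnorm_ge0.
rewrite unlock; have := integral_powR_le_energy _ _ cphi IH.
move=> /(@gt0_ler_poweR _ q^-1) h; apply: le_trans (h _ _ _) _.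
- by rewrite invr_ge0 ltW.
- rewrite in_itv/= leey andbT; apply: integral_ge0 => x _.
  by rewrite lee_fin powR_ge0.
- by rewrite in_itv/= leey andbT poweR_ge0.
- rewrite -poweRrM mulfV ?gt_eqF// poweRe1//.
  by apply: integral_ge0 => x _; rewrite lee_fin enorm_ge0.
Qed.
End gagliardo_nirenberg.

(** * Sets of finite measure and compactly supported functions *)

Section bounded_sets.
Context {R : realType}.

Lemma coord_le_norm n (x : 'rV[R]_n) j : `|x 0 j| <= `|x|.
Proof.
rewrite [leRHS]mx_normrE.
exact: (@le_bigmax _ _ _ 0 (fun ij => `|x ij.1 ij.2|) (0, j)).
Qed.

Definition box n (M : R) : set 'rV[R]_n := [set v | forall j, `|v 0 j| <= M].

Lemma measurable_box n M : measurable (box n M).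
Proof.
rewrite (_ : box n M = \bigcap_(j in [set: 'I_n])
    (fun v : 'rV[R]_n => v 0 j) @^-1` `[- M, M]).
  apply: fin_bigcap_measurable => // j _.
  by rewrite -[X in measurable X]setTI; exact: measurable_coord_rV.
apply/seteqP; split => v /= vM j.
  by move=> _ /=; rewrite in_itv/= -ler_norml.
by have := vM j I; rewrite /= in_itv/= -ler_norml.
Qed.

Lemma lebesgue_box_lty n M : (lebesgue_rV n (box n M) < +oo)%E.
Proof.
elim: n => [|n IH] /=.
  by rewrite diracE; case: (_ \in _); rewrite ltry.
rewrite /lebesgue_rV_step /pushforward.
rewrite (_ : _ @^-1` _ = `[- M, M]%classic `*` box n M); last first.
  apply/seteqP; split => -[t y] /=.
    move=> tyM; split => /=.
      by have := tyM 0; rewrite mxE unlift_none /= in_itv/= ler_norml.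
    by move=> j; have := tyM (lift 0 j); rewrite mxE liftK.
  rewrite in_itv/= -ler_norml => -[tM yM] j.
  by rewrite mxE; case: unliftP.
rewrite product_measure1E//; last exact: measurable_box.
have fin_itv : @lebesgue_measure R `[- M, M]%classic \is a fin_num.
  by rewrite lebesgue_measure_itv /=; case: ifP => // _; rewrite -EFinB.
by rewrite lte_mul_pinfty//; exact: fin_itv.
Qed.

Lemma bounded_set_box n (A : set 'rV[R]_n) : bounded_set A ->
  exists M, A `<=` box n M.
Proof.
move=> [M [_ AM]]; exists (M + 1) => x Ax j.
by apply: le_trans (coord_le_norm _ x j) (AM _ _ _ Ax); rewrite ltrDl.
Qed.

Lemma bounded_set_lebesgue_lty n (A : set 'rV[R]_n) : measurable A ->
  bounded_set A -> (lebesgue_rV n A < +oo)%E.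
Proof.
move=> mA /bounded_set_box[M AM]; apply: le_lt_trans (lebesgue_box_lty n M).
by apply: le_measure => //; rewrite inE//; exact: measurable_box.
Qed.

End bounded_sets.

Section C1_supported.
Context {R : realType} {n : nat}.
Implicit Types (Omega : set 'rV[R]_n) (phi psi : 'rV[R]_n -> R).

(** Test functions enter the argument only through their first derivatives. *)
Definition C1_supported Omega phi :=
  [/\ continuous phi, forall i x, derivable phi x (delta_mx 0 i),
      forall i, continuous (pderiv i phi)
    & exists K, [/\ compact K, K `<=` Omega & forall x, ~ K x -> phi x = 0]].

Lemma C1_supported_test Omega phi : test_function Omega phi -> C1_supported Omega phi.
Proof.
move=> [sphi cphi phiO]; split.
- exact: (sphi [::]).1.
- exact: (sphi [::]).2.
- by move=> i; exact: (sphi [:: i]).1.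
- exists (Defs.support phi); split => // x nx; apply: contrapT => phix; apply: nx.
  by apply: subset_closure; exact/eqP.
Qed.

Lemma pderiv_lin a phi psi i : (forall x, derivable phi x (delta_mx 0 i)) ->
  (forall x, derivable psi x (delta_mx 0 i)) ->
  pderiv i (a *: phi + psi) = a *: pderiv i phi + pderiv i psi.
Proof.
move=> dphi dpsi; apply/funext => x; rewrite /pderiv deriveD//.
  by rewrite deriveZ.
exact: derivableZ.
Qed.

Lemma grad_lin a phi psi : (forall i x, derivable phi x (delta_mx 0 i)) ->
  (forall i x, derivable psi x (delta_mx 0 i)) ->
  grad (a *: phi + psi) = a *: grad phi + grad psi.
Proof.
move=> dphi dpsi; apply/funext => x; apply/rowP => i.
by rewrite !mxE pderiv_lin.
Qed.

Lemma C1_supported_lin Omega a phi psi : C1_supported Omega phi ->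
  C1_supported Omega psi -> C1_supported Omega (a *: phi + psi).
Proof.
move=> [cphi dphi cdphi [K [cK KO phiK]]] [cpsi dpsi cdpsi [L [cL LO psiL]]]; split.
- by move=> x; apply: cvgD (cpsi x); apply: cvgZl_tmp; exact: cphi.
- by move=> i x; apply: derivableD => //; exact: derivableZ.
- move=> i; rewrite pderiv_lin// => x.
  by apply: cvgD (cdpsi i x); apply: cvgZl_tmp; exact: cdphi.
- exists (K `|` L); split; first exact: compactU.
    by move=> x [/KO|/LO].
  move=> x /not_orP[nK nL].
  by rewrite (_ : (_ + _) x = a * phi x + psi x)// phiK// psiL// mulr0 addr0.
Qed.

Lemma pderiv_supported phi (K : set 'rV[R]_n) i x : compact K ->
  (forall x, ~ K x -> phi x = 0) -> ~ K x -> pderiv i phi x = 0.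
Proof.
move=> cK phiK nKx; apply: pderiv_near0.
have clK : closed K by apply: compact_closed => //; exact: norm_hausdorff.
have : nbhs x (~` K) by apply: open_nbhs_nbhs; split => //; exact: closed_openC.
by apply: filterS => y; exact: phiK.
Qed.

Lemma bounded_measurable_supported (f : 'rV[R]_n -> R) (K : set 'rV[R]_n) :
  continuous f -> compact K -> (forall x, ~ K x -> f x = 0) -> bounded_measurable f.
Proof.
move=> cf cK fK; split; first exact: continuous_measurable_rV.
have : compact (f @` K).
  by apply: continuous_compact => //; exact: continuous_subspaceT.
move=> /compact_bounded[M [_ fM]]; exists (`|M| + 1) => x.
have [Kx|nKx] := pselect (K x); last by rewrite fK// normr0 addr_ge0.
by apply: (fM _ _ (f x)); [rewrite (le_lt_trans (ler_norm _))// ltrDl|exists x].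
Qed.

Lemma C1_supported_bounded Omega phi : C1_supported Omega phi ->
  bounded_measurable phi.
Proof.
by move=> [cf _ _ [K [cK _ fK]]]; exact: (bounded_measurable_supported _ K).
Qed.

Lemma C1_supported_grad_bounded Omega phi : C1_supported Omega phi ->
  bounded_measurable_field (grad phi).
Proof.
move=> [_ _ cd [K [cK _ phiK]]] i; under eq_fun do rewrite mxE.
apply: (bounded_measurable_supported _ K (cd i) cK) => x nKx.
exact: (pderiv_supported phi K).
Qed.

Lemma C1_supported_out Omega phi x : C1_supported Omega phi -> ~ Omega x ->
  phi x = 0 /\ grad phi x = 0.
Proof.
move=> [_ _ cd [K [cK KO phiK]]] nOx; split; first by apply: phiK => /KO.
apply/rowP => i; rewrite !mxE; apply: (pderiv_supported _ _ _ _ cK phiK).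
by move=> /KO.
Qed.

Lemma C1_supported_compact Omega phi : bounded_set Omega ->
  C1_supported Omega phi -> C1_compact phi.
Proof.
move=> /bounded_set_box[M OM] [? ? ? [K [cK KO phiK]]]; split => //.
exists M => x j Mx; apply: phiK => /KO/OM/(_ j).
by rewrite leNgt Mx.
Qed.

End C1_supported.

(** * Existence of a calibration *)

Section restricted_integral.
Context {d} {T : measurableType d} {R : realType}.
Variables (mu : {measure set T -> \bar R}) (D : set T).
Hypotheses (mD : measurable D) (muD : (mu D < +oo)%E).

Lemma Rintegral_mfrestr f : bounded_measurable f ->
  \int[mfrestr mD muD]_x f x = \int[mu]_(x in D) f x.
Proof.
move=> bf; rewrite /Rintegral (negligible_integral (measurableC mD))//.
- by rewrite setTD setCK; congr fine; apply: eq_measure_integral => A mA AD;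
    rewrite /= /mfrestr /mrestr setIidl.
- exact: bounded_measurable_integrable.
- by rewrite /= /mfrestr /mrestr setICl measure0.
Qed.

End restricted_integral.

Section calibration.
Context {R : realType} {n : nat}.
Variables (Omega : set 'rV[R]_n.+1) (g : 'rV[R]_n.+1 -> R).
Hypotheses (oOmega : open Omega) (bOmega : bounded_set Omega).
Hypotheses (mg : measurable_fun Omega g)
  (normg : (norm_L Omega n.+1%:R%:E g <= 1)%E).
Local Notation leb := (@lebesgue_rV R n.+1).

Let mOmega : measurable Omega.
Proof. exact: open_measurable_rV. Qed.

Let lebOmega : (leb Omega < +oo)%E.
Proof. exact: bounded_set_lebesgue_lty. Qed.

Let mg0 : measurable_fun setT (g \_ Omega).
Proof. exact/(measurable_restrictT _ mOmega). Qed.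

(** On a set of finite measure [L^N] is contained in [L^1], because
    [|x| <= 1 + |x|^N]. *)
Lemma integrable_norm_L : leb.-integrable setT (EFin \o (g \_ Omega)).
Proof.
apply/integrableP; split; first exact/measurable_EFinP.
have le_pow (x : R) : `|x| <= 1 + `|x| ^+ n.+1.
  have [x1|x1] := lerP `|x| 1; first by rewrite (le_trans x1)// lerDl exprn_ge0.
  by rewrite (le_trans (ler_eXnr (n := n.+1) _ (ltW x1)))// lerDr.
apply: (@le_lt_trans _ _ (leb Omega + \int[leb]_x (`|(g \_ Omega) x| ^+ n.+1)%:E)%E).
  have -> : leb Omega = (\int[leb]_x (\1_Omega x)%:E)%E.
    by rewrite integral_indic// setIT.
  rewrite -ge0_integralD//; last 2 first.
  - by apply/measurable_EFinP; exact: measurable_indic.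
  - by apply/measurable_EFinP; apply: measurable_funX; exact: measurableT_comp.
  apply: ge0_le_integral => //.
  - by apply/measurable_EFinP; exact: measurableT_comp.
  - apply/measurable_EFinP; apply: measurable_funD; first exact: measurable_indic.
    by apply: measurable_funX; exact: measurableT_comp.
  - move=> x _; rewrite /= -EFinD lee_fin /patch indicE.
    case: (x \in Omega); first exact: le_pow.
    by rewrite normr0 expr0n addr0.
apply: lte_add_pinfty => //.
have : ('N[leb]_(n.+1%:R%:E)[EFin \o (g \_ Omega)] < +oo)%E.
  by apply: le_lt_trans normg _; rewrite ltry.
move=> /(@poweR_lty _ _ n.+1%:R); rewrite poweR_Lnorm ?pnatr_eq0//.
congr (_ < _)%E; apply: eq_integral => x _ /=.
by rewrite powR_mulrn.
Qed.

Lemma integrable_norm_L_on : leb.-integrable Omega (EFin \o g).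
Proof.
by apply/(integrable_mkcond _ mOmega); rewrite restrict_EFin; exact: integrable_norm_L.
Qed.

(** The functional to be extended is dominated on gradients: this is where the
    bound on the norm of [g] is used. *)
Lemma integral_mul_le_energy phi : C1_supported Omega phi ->
  \int[leb]_(x in Omega) (g x * phi x) <=
  \int[leb]_(x in Omega) enorm (grad phi x).
Proof.
move=> sphi; have cphi := C1_supported_compact _ _ bOmega sphi.
have bphi := C1_supported_bounded _ _ sphi.
have igphi := integrable_mul_bounded _ _ _ _ mOmega integrable_norm_L_on bphi.
pose gphi x := `|g x * phi x|.
have benergy := bounded_measurable_enorm _ (C1_supported_grad_bounded _ _ sphi).
apply: le_trans (ler_norm _) _.
apply: le_trans (le_normr_Rintegral mOmega igphi) _.
rewrite -lee_fin /Rintegral !fineK; last 2 first.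
- apply: integrable_fin_num => //; apply: measurable_bounded_integrable => //.
    exact: measurable_funTS benergy.1.
  have [_ [C eC]] := benergy.
  by exists C; split=> [|M CM x _]; [exact: num_real|exact: le_trans (eC x) (ltW CM)].
- exact: (integrable_fin_num mOmega (integrable_norm igphi)).
rewrite integral_mkcond [leRHS]integral_mkcond.
have := gagliardo_nirenberg _ _ _ cphi mg0.
rewrite (_ : (\int[leb]_x `|(g \_ Omega) x * phi x|%:E)%E =
   (\int[leb]_x ((EFin \o gphi) \_ Omega) x)%E); last first.
  apply: eq_integral => x _; rewrite /patch /=; case: ifPn => // _.
  by rewrite mul0r normr0.
move=> /le_trans; apply.
rewrite -[leRHS]mul1e; apply: lee_pmul => //; first exact: Lnorm_ge0.
  by apply: integral_ge0 => x _; rewrite lee_fin enorm_ge0.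
rewrite le_eqVlt; apply/orP; left; apply/eqP.
apply: eq_integral => x _; rewrite /patch /=; case: ifPn => // /negP xO.
have [_ ->] := C1_supported_out _ _ x sphi (fun h => xO (mem_set h)).
by rewrite enorm0.
Qed.

(** The relation [G0] consists of the pairs [(grad phi, \int g phi)]. It is
    extended to a functional on bounded measurable fields, dominated by the
    [L^1] norm on [Omega], and [z] represents this functional. *)
Theorem calibration : exists z : 'rV[R]_n.+1 -> 'rV[R]_n.+1,
  [/\ forall i, measurable_fun setT (fun x => z x 0 i),
      forall x, enorm (z x) <= 1
    & forall phi, C1_supported Omega phi ->
        \int[leb]_(x in Omega) edot (z x) (grad phi x) =
        \int[leb]_(x in Omega) (g x * phi x)].
Proof.
pose mu := mfrestr mOmega lebOmega : {finite_measure set _ -> \bar R}.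
have intE f : bounded_measurable f ->
    \int[mu]_x f x = \int[leb]_(x in Omega) f x.
  exact: Rintegral_mfrestr.
pose p (F : 'rV[R]_n.+1 -> 'rV[R]_n.+1) := \int[mu]_x enorm (F x).
have D_lin a (F G : 'rV[R]_n.+1 -> 'rV[R]_n.+1) : bounded_measurable_field F ->
  bounded_measurable_field G -> bounded_measurable_field (a *: F + G).
  exact: bounded_measurable_field_lin.
have i_enorm (F : 'rV[R]_n.+1 -> 'rV[R]_n.+1) : bounded_measurable_field F ->
    mu.-integrable setT (EFin \o (fun x => enorm (F x))).
  move=> bF; apply: bounded_measurable_integrable => //.
  exact: bounded_measurable_enorm.
have p_sub F G : bounded_measurable_field F -> bounded_measurable_field G ->
    p (F + G) <= p F + p G.
  move=> bF bG; rewrite /p -RintegralD//; try exact: i_enorm.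
  apply: le_Rintegral => //.
  - by apply: i_enorm; rewrite -[F]scale1r; exact: D_lin.
  - exact: (integrableD measurableT (i_enorm _ bF) (i_enorm _ bG)).
  - by move=> x _; exact: enormD.
have p_hom a F : 0 < a -> bounded_measurable_field F -> p (a *: F) = a * p F.
  move=> a0 bF; rewrite /p -RintegralZl//; last exact: i_enorm.
  by apply: eq_Rintegral => x _; rewrite enormZ gtr0_norm.
pose G0 := [set u : ('rV[R]_n.+1 -> 'rV[R]_n.+1) * R^o | exists phi,
  C1_supported Omega phi /\ u = (grad phi, \int[leb]_(x in Omega) (g x * phi x))].
have G0_lin : dominated_linear_relation bounded_measurable_field p G0.
  split.
    move=> a _ _ [phi [sphi ->]] [psi [spsi ->]]; exists (a *: phi + psi).
    split; first exact: C1_supported_lin.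
    have [_ dphi _ _] := sphi; have [_ dpsi _ _] := spsi.
    rewrite grad_lin//; congr pair.
    have bphi := C1_supported_bounded _ _ sphi.
    have bpsi := C1_supported_bounded _ _ spsi.
    have igphi := integrable_mul_bounded _ _ _ _ mOmega integrable_norm_L_on bphi.
    have igpsi := integrable_mul_bounded _ _ _ _ mOmega integrable_norm_L_on bpsi.
    have := Rintegral_linear leb Omega a _ _ mOmega igphi igpsi.
    by under eq_Rintegral do rewrite mulrCA -mulrDr.
  move=> _ [phi [sphi ->]] /=; have bg := C1_supported_grad_bounded _ _ sphi.
  split => //; rewrite /p intE; first exact: integral_mul_le_energy.
  exact: bounded_measurable_enorm.
have G00 : G0 0.
  exists (cst 0); split; last first.
    congr pair; last first.
      by under eq_Rintegral do rewrite mulr0; rewrite Rintegral_cst// mul0r.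
    by apply/funext => x; apply/rowP => i; rewrite !mxE; exact/esym/derive_cst.
  have pderiv0 i : pderiv i (cst 0 : 'rV[R]_n.+1 -> R) = cst 0.
    by apply/funext => x; exact: derive_cst.
  split; [by move=> x; exact: cst_continuous|by move=> i x; exact: derivable_cst|..].
    by move=> i; rewrite pderiv0 => x; exact: cst_continuous.
  by exists set0; split => //; exact: compact0.
have [L [L_lin L_dom LE]] := hahn_banach _ _ D_lin p_sub p_hom _ G00 G0_lin.
have [z [mz z1 zE]] := riesz_L1_dual mu L L_lin L_dom.
exists z; split => // phi sphi.
have := LE (grad phi, \int[leb]_(x in Omega) (g x * phi x)).
move=> /(_ (ex_intro _ phi (conj sphi erefl))) /= <-.
have bg := C1_supported_grad_bounded _ _ sphi.
rewrite zE// intE//; split.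
  by apply: measurable_edot => // i; exact: (bg i).1.
have [_ [C eC]] := bounded_measurable_enorm _ bg; exists C => x.
rewrite (le_trans (normr_edot_le _ _))// (le_trans _ (eC x))//.
by rewrite [leRHS]ger0_norm ?enorm_ge0// ler_piMl ?enorm_ge0.
Qed.

End calibration.

(** * Integrals with respect to charges *)

Section charge_integrals.
Context {R : realType} {n : nat}.
Local Notation charges := ({charge set 'rV[R]_n -> \bar R})%R.
Implicit Types (A Omega : set 'rV[R]_n) (f w : 'rV[R]_n -> R).

Lemma charge_integral_cst0 (nu : charges) A : charge_integral nu A (fun=> 0) = 0.
Proof.
rewrite /charge_integral; case: cid => P exN; case: cid => N nuPN.
by rewrite /Rintegral !integral0 subrr.
Qed.

Lemma charge_integral_null (nu : charges) A f :
  (forall B, measurable B -> nu B = 0%E) -> measurable A ->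
  charge_integral nu A f = 0.
Proof.
move=> nu0 mA; rewrite /charge_integral; case: cid => P exN; case: cid => N nuPN.
have [[mP _] [mN _] _ _] := nuPN.
rewrite /Rintegral (@eq_measure_integral _ _ _ _ mzero); last first.
  move=> B mB _ /=.
  rewrite jordan_posE cjordan_posE /crestr0 mem_set// /crestr nu0//.
  exact: measurableI.
rewrite (@eq_measure_integral _ _ _ _ mzero (jordan_neg nuPN)); last first.
  move=> B mB _ /=.
  rewrite jordan_negE cjordan_negE /crestr0 mem_set// /crestr nu0 ?oppe0//.
  exact: measurableI.
by rewrite !integral_measure_zero subr0.
Qed.

(** Both sides are linear in [f], bounded by a multiple of [sup |f|], and agree
    on indicators by the Jordan decomposition of the charge. *)
Lemma charge_integral_induced (mu : {measure set 'rV[R]_n -> \bar R}) w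
    (iw : mu.-integrable setT (EFin \o w)) Omega f :
  measurable Omega -> bounded_measurable f ->
  charge_integral (induced_charge iw) Omega f = \int[mu]_(x in Omega) (w x * f x).
Proof.
move=> mO; rewrite /charge_integral; case: cid => P exN; case: cid => N nuPN.
set pos := jordan_pos nuPN; set neg := jordan_neg nuPN => bf.
apply/eqP; rewrite -subr_eq0; apply/eqP; move: f bf.
have iwO : mu.-integrable Omega (EFin \o w).
  exact: (integrableS measurableT mO (@subsetT _ Omega) iw).
apply: (@bounded_measurable_linear_eq0 _ _ _ (fun f =>
    \int[pos]_(x in Omega) f x - \int[neg]_(x in Omega) f x -
    \int[mu]_(x in Omega) (w x * f x))
   (fine (pos Omega) + fine (neg Omega) + \int[mu]_(x in Omega) `|w x|)).
- move=> a f h bf bh.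
  have lin (m : {finite_measure set 'rV[R]_n -> \bar R}) :
      \int[m]_(x in Omega) (a *: f + h) x =
      a * \int[m]_(x in Omega) f x + \int[m]_(x in Omega) h x.
    by apply: Rintegral_linear => //; exact: bounded_measurable_integrable.
  rewrite !lin.
  have := Rintegral_linear mu Omega a (fun x => w x * f x) (fun x => w x * h x) mO.
  under eq_Rintegral do rewrite mulrCA -mulrDr.
  move=> ->; [ring|exact: integrable_mul_bounded..].
- move=> A mA.
  have mAO : measurable (A `&` Omega) by exact: measurableI.
  rewrite {1 2}/Rintegral !integral_indic//.
  have -> : \int[mu]_(x in Omega) (w x * \1_A x) = fine (induced_charge iw (A `&` Omega)).
    rewrite /induced_charge setIC integral_mkcondr; congr fine.
    apply: eq_integral => x _; rewrite /patch indicE.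
    by case: (x \in A); rewrite ?mulr1 ?mulr0.
  rewrite (jordan_decomp nuPN mAO) /cadd/= cscaleN1 fineB ?subrr//.
  - exact: (fin_num_measure pos).
  - exact: (fin_num_measure neg).
- move=> f C bf fC.
  have bound (m : {finite_measure set 'rV[R]_n -> \bar R}) :
      `|\int[m]_(x in Omega) f x| <= fine (m Omega) * C.
    have im := bounded_measurable_integrable m Omega f mO bf.
    apply: le_trans (le_normr_Rintegral mO im) _.
    rewrite mulrC -Rintegral_cst//; apply: le_Rintegral => //.
      exact: integrable_norm.
    by apply: bounded_measurable_integrable => //; exact: bounded_measurable_cst.
  have iwf := integrable_mul_bounded mu Omega w f mO iwO bf.
  rewrite (le_trans (ler_normB _ _))// mulrDl lerD//.
    by rewrite (le_trans (ler_normB _ _))// mulrDl lerD// bound.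
  apply: le_trans (le_normr_Rintegral mO iwf) _.
  rewrite -RintegralZr//; last exact: integrable_norm.
  apply: le_Rintegral => //; first exact: integrable_norm.
    apply: integrable_mul_bounded => //; first exact: integrable_norm.
    exact: bounded_measurable_cst.
  by move=> x _; rewrite normrM ler_wpM2l.
Qed.

End charge_integrals.

(** * The zero function is a solution *)

Section zero_function.
Context {R : realType} {n : nat}.
Implicit Types (A Omega : set 'rV[R]_n) (x : 'rV[R]_n).
Local Notation zero := (fun=> 0 : 'rV[R]_n -> R).
Local Notation charges := ({charge set 'rV[R]_n -> \bar R})%R.

Lemma average0 A : average A (fun=> 0) = 0.
Proof. by rewrite /average /Rintegral integral0 mulr0. Qed.

Lemma precise_representative0 Omega x :
  precise_representative Omega (fun=> 0) x = 0.
Proof.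
rewrite /precise_representative; case: xgetP => // l _ /=.
under eq_fun do rewrite average0.
by move=> l0; apply/esym/(cvg_unique _ _ l0) => //; exact: cvg_cst.
Qed.

Lemma weight0 Omega gamma : weight Omega gamma (fun=> 0) = cst 1%E.
Proof.
apply/funext => x; rewrite /weight precise_representative0 subr0 powR1.
by rewrite inver oner_eq0 invr1.
Qed.

Lemma approx_limit0 Omega x : approx_limit Omega (fun=> 0) x 0.
Proof.
rewrite /approx_limit; under eq_fun do rewrite subr0 normr0.
by under eq_fun do rewrite average0; exact: cvg_cst.
Qed.

Lemma hausdorff_measure0 (s : nat) : hausdorff_measure s (set0 : set 'rV[R]_n) = 0%E.
Proof.
have size0 : hausdorff_size s (set0 : set 'rV[R]_n) = 0%E by rewrite /hausdorff_size eqxx.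
have diam0 A : (0 <= diameter A)%E \/ A = set0.
  have [->|/set0P[x Ax]] := eqVneq A set0; [by right|left].
  apply: ereal_sup_ubound; exists (x, x) => //=.
  by rewrite subrr enorm0.
have size_ge0 A : (0 <= hausdorff_size s A)%E.
  rewrite /hausdorff_size; case: ifPn => // /eqP A0; apply: expe_ge0.
  by have [] := diam0 A.
apply/eqP; rewrite eq_le; apply/andP; split.
  apply: ge_ereal_sup => _ [delta _ <-]; apply: ereal_inf_lbound.
  exists (fun=> set0); last by rewrite eseries0.
  by split => // _; rewrite /diameter set0X image_set0 ereal_sup0 leNye.
apply: (@le_trans _ _ (ereal_inf _)); last first.
  by apply: ereal_sup_ubound; exists 1; [exact: ltr01|reflexivity].
by apply: le_ereal_inf_tmp => _ [F _ <-]; exact: nneseries_ge0.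
Qed.

Lemma has_trace0 Omega : has_trace Omega (fun=> 0) (fun=> 0).
Proof.
rewrite /has_trace [X in hausdorff_measure _ X](_ : _ = set0) ?hausdorff_measure0//.
by apply/seteqP; split => // x [_]; apply; exact: approx_limit0.
Qed.

Lemma vector_variation0 A : measurable A ->
  vector_variation (fun=> czero : charges) A = 0%E.
Proof.
move=> mA; rewrite /vector_variation [X in ereal_sup X](_ : _ = [set 0%E]) ?ereal_sup1//.
have enorm_czero F : (fun k : nat => (enorm (\row_(i < n)
    fine (@czero _ 'rV[R]_n R (F k))))%:E) = cst 0%E.
  apply/funext => k; rewrite (_ : \row_i _ = 0) ?enorm0//.
  by apply/rowP => i; rewrite !mxE.
apply/seteqP; split => [_ [F [_ _ _ ->]]|_ ->].
  by rewrite /= eseries0// => k _ _; have /= := congr1 (fun f => f k) (enorm_czero F).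
pose F k := if k == 0%N then A else set0.
exists F; split; rewrite /F.
- by move=> [|k] /=.
- by move=> [|i] [|j] _ _ //= [x []].
- by apply/seteqP; split => [x [[|k] _]|x Ax]//; exists 0%N.
- by rewrite eseries0// => k _ _; have /= := congr1 (fun f => f k) (enorm_czero F).
Qed.

Lemma pairing0 Omega z (divz : charges) phi :
  pairing Omega z divz (fun=> 0) phi = 0.
Proof.
rewrite /pairing (_ : (fun x => _) = fun=> 0); last first.
  by apply/funext => x; rewrite precise_representative0 mul0r.
rewrite charge_integral_cst0 oppr0 sub0r; under eq_Rintegral do rewrite mul0r.
by rewrite /Rintegral integral0 oppr0.
Qed.

End zero_function.

(** The solution is [u = 0], with the field [z] of [calibration] and with
    [div z] the charge [- g dx] on [Omega]. *)
Theorem theorem1 (R : realType) (N : nat) (Omega : set 'rV[R]_N) (gamma : R)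
  (g : 'rV[R]_N -> R) :
  (0 < N)%N ->
  open Omega -> bounded_set Omega ->
  1 < gamma ->
  measurable_fun Omega g ->
  {ae lebesgue_rV N, forall x : 'rV[R]_N, Omega x -> 0 <= g x} ->
  (norm_L Omega N%:R%:E g <= 1)%E ->
  exists u : 'rV[R]_N -> R, solution Omega gamma g u.
Proof.
case: N Omega g => [//|n] Omega g _ oO bO _ mg _ ng.
have mO : measurable Omega by exact: open_measurable_rV.
have [z [mz z1 zE]] := calibration Omega g oO bO mg ng.
have ig := integrable_norm_L Omega g oO bO mg ng.
have iNg : (lebesgue_rV n.+1).-integrable setT (EFin \o (fun x => - (g \_ Omega) x)).
  exact: integrableN ig.
pose Du : 'I_n.+1 -> {charge set 'rV[R]_n.+1 -> \bar R} := fun=> czero.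
pose absDu : {finite_measure set 'rV[R]_n.+1 -> \bar R} := mzero.
have czeroE A f : measurable A -> charge_integral (@czero _ 'rV[R]_n.+1 R) A f = 0.
  by move=> mA; exact: charge_integral_null.
have gradient0 : is_gradient Omega (fun=> 0) Du.
  move=> i phi _; rewrite czeroE// oppr0.
  by under eq_Rintegral do rewrite mul0r; rewrite Rintegral_cst// mul0r.
have divE phi : test_function Omega phi ->
    charge_integral (induced_charge iNg) Omega phi =
    - \int[lebesgue_rV n.+1]_(x in Omega) (g x * phi x).
  move=> /C1_supported_test/C1_supported_bounded bphi.
  rewrite charge_integral_induced// -mulN1r -RintegralZl//; last first.
    by apply: integrable_mul_bounded => //; exact: integrable_norm_L_on.
  by apply: eq_Rintegral => x xO; rewrite /patch xO mulN1r mulNr.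
have normz : (norm_L Omega +oo (enorm \o z) <= 1)%E.
  rewrite /norm_L unlock; case: ifP => // _; apply/ess_supP/aeW => x /=.
  rewrite lee_fin /patch; case: ifP => _; last by rewrite normr0 ler01.
  by rewrite ger0_norm; [exact: z1|exact: enorm_ge0].
exists (fun=> 0); split.
- split; last by exists Du.
  rewrite (_ : _ \o _ = cst 0%E); last by [].
  exact: integrable0.
- by apply/aeW => x _; rewrite lexx ltr01.
- exact: has_trace0.
exists Du, absDu; split => //.
- by move=> A mA AO; rewrite vector_variation0.
- exists Du, Du, Du; split; last exact: vector_variation0.
  exists Du => //; split => //.
  + by move=> i A mA AO; rewrite /= /Du /= /czero adde0.
  + by exists set0 => //; split => //; rewrite measure0.
exists z, (induced_charge iNg); split => //.
- split.
  + by move=> i; exact: measurable_funTS.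
  + by rewrite (le_lt_trans normz)// ltry.
  + move=> phi tphi; rewrite divE// zE//.
    exact: C1_supported_test.
- move=> K cK KO; rewrite weight0; apply/integrableP; split => //.
  by rewrite integral_measure_zero.
- move=> phi tphi; rewrite divE// opprK.
  rewrite integral_measure_zero addr0//.
- exists czero; split => //= phi tphi.
  by rewrite czeroE// pairing0.
Qed.
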